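(* Let $\tilde{\mathfrak{C}}=(\tilde V,\langle\cdot,\cdot\rangle,\tilde J,\tilde A)$ be a para-Hermitian curvature model. Then $\tilde{\mathfrak{C}}$ is geometrically realized by a para-Hermitian manifold if and only if $\tilde A$ satisfies the para-Gray identity, i.e. for all $x,y,z,w\in\tilde V$, $$\begin{aligned}0={}&\tilde A(x,y,z,w)+\tilde A(\tilde Jx,\tilde Jy,\tilde Jz,\tilde Jw)+\tilde A(\tilde Jx,\tilde Jy,z,w)+\tilde A(\tilde Jx,y,\tilde Jz,w)\\&+\tilde A(\tilde Jx,y,z,\tilde Jw)+\tilde A(x,\tilde Jy,\tilde Jz,w)+\tilde A(x,\tilde Jy,z,\tilde Jw)+\tilde A(x,y,\tilde Jz,\tilde Jw).\end{aligned}$$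
   Context: A para-Hermitian structure $(\tilde V,\langle\cdot,\cdot\rangle,\tilde J)$ consists of a real vector space $\tilde V$ of finite dimension $2n$, a non-degenerate symmetric bilinear form $\langle\cdot,\cdot\rangle$ of neutral signature $(n,n)$, and a linear map $\tilde J:\tilde V\to\tilde V$ with $\tilde J^2=\operatorname{id}$ and $\langle\tilde Jx,\tilde Jy\rangle=-\langle x,y\rangle$ for all $x,y$. An algebraic curvature tensor on $\tilde V$ is $\tilde A\in\otimes^4\tilde V^*$ with $\tilde A(x,y,z,w)+\tilde A(y,z,x,w)+\tilde A(z,x,y,w)=0$ and $\tilde A(x,y,z,w)=-\tilde A(y,x,z,w)=\tilde A(z,w,x,y)$. A para-Hermitian curvature model is a tuple $(\tilde V,\langle\cdot,\cdot\rangle,\tilde J,\tilde A)$ where $(\tilde V,\langle\cdot,\cdot\rangle,\tilde J)$ is a para-Hermitian structure and $\tilde A$ is an algebraic curvature tensor on $\tilde V$. An almost para-Hermitian manifold $(\tilde M,\tilde g,\tilde{\mathcal J})$ is a smooth pseudo-Riemannian manifold $(\tilde M,\tilde g)$ of dimension $2n$ with a smooth endomorphism field $\tilde{\mathcal J}$ of $T\tilde M$ satisfying $\tilde{\mathcal J}^2=\operatorname{id}$ and $\tilde{\mathcal J}^*\tilde g=-\tilde g$ (so $\tilde g$ has neutral signature $(n,n)$). It is para-Hermitian if $\tilde{\mathcal J}$ is integrable, i.e. the Nijenhuis tensor $N(x,y)=[x,y]-\tilde{\mathcal J}[\tilde{\mathcal J}x,y]-\tilde{\mathcal J}[x,\tilde{\mathcal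 J}y]+[\tilde{\mathcal J}x,\tilde{\mathcal J}y]$ vanishes; equivalently, near any point there are local coordinates $(x_1,\dots,x_n,y_1,\dots,y_n)$ centered at that point with $\tilde{\mathcal J}\partial_{x_i}=\partial_{y_i}$ and $\tilde{\mathcal J}\partial_{y_i}=\partial_{x_i}$. The curvature of the Levi-Civita connection is $\tilde R(x,y)=\nabla_x\nabla_y-\nabla_y\nabla_x-\nabla_{[x,y]}$, and $\tilde R(x,y,z,w)=\tilde g(\tilde R(x,y)z,w)$. The model $(\tilde V,\langle\cdot,\cdot\rangle,\tilde J,\tilde A)$ is geometrically realized by $(\tilde M,\tilde g,\tilde{\mathcal J})$ if there are a point $P\in\tilde M$ and a linear isomorphism $\phi:\tilde V\to T_P\tilde M$ with $\phi^*\tilde g_P=\langle\cdot,\cdot\rangle$, $\phi^*\tilde{\mathcal J}_P=\tilde J$ and $\phi^*\tilde R_P=\tilde A$. *)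

(* Defs.v *)
From HB Require Import structures.
From mathcomp Require Import all_boot all_order all_algebra.
From mathcomp Require Import all_classical all_reals all_analysis.

Set Implicit Arguments.
Unset Strict Implicit.
Unset Printing Implicit Defensive.

Import Order.TTheory GRing.Theory Num.Theory numFieldNormedType.Exports.

Local Open Scope classical_set_scope.
Local Open Scope ring_scope.

Section Algebra.
Context {R : realType} {V : vectType R}.
Implicit Types (b : V -> V -> R) (J : V -> V) (A : V -> V -> V -> V -> R).

Definition bilinear_form b : Prop :=
  (forall y, scalar (fun x => b x y)) /\ (forall x, scalar (fun y => b x y)).

Definition has_signature b (p q : nat) : Prop :=
  exists e : (p + q).-tuple V, basis_of fullv e /\
    forall i j : 'I_(p + q),
      b (tnth e i) (tnth e j) = (-1) ^+ (p <= i)%N *+ (i == j).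

Record para_hermitian_structure (n : nat) b J : Prop := {
  phs_dim : \dim {: V} = n.*2;
  phs_bilinear : bilinear_form b;
  phs_sym : forall x y, b x y = b y x;
  phs_nondegenerate : forall x, (forall y, b x y = 0) -> x = 0;
  phs_signature : has_signature b n n;
  phs_linear : linear J;
  phs_involutive : forall x, J (J x) = x;
  phs_skew : forall x y, b (J x) (J y) = - b x y
}.

Record algebraic_curvature_tensor A : Prop := {
  act_linear1 : forall y z w, scalar (fun x => A x y z w);
  act_linear2 : forall x z w, scalar (fun y => A x y z w);
  act_linear3 : forall x y w, scalar (fun z => A x y z w);
  act_linear4 : forall x y z, scalar (fun w => A x y z w);
  act_bianchi : forall x y z w, A x y z w + A y z x w + A z x y w = 0;
  act_skew : forall x y z w, A x y z w = - A y x z w;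
  act_pair : forall x y z w, A x y z w = A z w x y
}.

Definition para_hermitian_curvature_model (n : nat) b J A : Prop :=
  para_hermitian_structure n b J /\ algebraic_curvature_tensor A.

Definition para_gray_identity J A : Prop := forall x y z w,
  0 = A x y z w + A (J x) (J y) (J z) (J w)
      + A (J x) (J y) z w + A (J x) y (J z) w
      + A (J x) y z (J w) + A x (J y) (J z) w
      + A x (J y) z (J w) + A x y (J z) (J w).

End Algebra.

Section Smooth.
Context {R : realType} {E F : normedModType R}.

Fixpoint class_C (k : nat) (U : set E) (f : E -> F) : Prop :=
  if k is k'.+1 then
    (forall x, U x -> differentiable f x) /\
    (forall v, class_C k' U (fun x => 'D_v f x))
  else forall x, U x -> {for x, continuous f}.

(* Only meaningful for open [U]: the values of [f] outside [U] are then
   irrelevant. *)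
Definition smooth_on (U : set E) (f : E -> F) : Prop :=
  forall k, class_C k U f.

End Smooth.

(* [chart_inv c] is the inverse of the chart [coord c], with unspecified values
   outside the open set [coord c @` dom c]. The atlas need not be maximal. *)
Record manifold (R : realType) (m : nat) := Manifold {
  point_of :> topologicalType;
  chart : Type;
  dom : chart -> set point_of;
  coord : chart -> point_of -> 'rV[R]_m;
  chart_inv : chart -> 'rV[R]_m -> point_of;
  manifold_hausdorff : hausdorff_space point_of;
  manifold_second_countable : @second_countable point_of;
  dom_open : forall c, open (dom c);
  dom_cover : forall p, exists c, dom c p;
  coord_open : forall c, open (coord c @` dom c);
  coordK : forall c p, dom c p -> chart_inv c (coord c p) = p;
  coord_continuous : forall c p, dom c p -> {for p, continuous (coord c)};
  chart_inv_continuous : forall c x, (coord c @` dom c) x ->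
    {for x, continuous (chart_inv c)};
  transition_smooth : forall c d,
    smooth_on (coord c @` (dom c `&` dom d)) (coord d \o chart_inv c)
}.

Section Geometry.
Context {R : realType} {m : nat} {M : manifold R m}.

(* A tangent vector at [p] is the family of its coordinate vectors in all the
   charts around [p], related by the Jacobians of the transition maps. Families
   are extended by 0 to the charts that do not contain [p], so that T_pM is the
   linear subspace [tangent p] of the space [TM] of all families. *)
Local Notation TM := (chart M -> 'rV[R]_m).

Implicit Types (p : M) (c d : chart M) (U : set M) (f : M -> R).
Implicit Types (X Y Z : M -> TM) (g : M -> TM -> TM -> R) (J : M -> TM -> TM).
Implicit Types (nabla : (M -> TM) -> (M -> TM) -> (M -> TM)).

Definition tangent p : set TM := [set v |
  (forall c, ~ dom c p -> v c = 0) /\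
  (forall c d, dom c p -> dom d p ->
     v d = 'd (coord d \o chart_inv c) (coord c p) (v c))].

Definition smooth_function U f : Prop := forall c,
  smooth_on (coord c @` (U `&` dom c)) (f \o chart_inv c).

Definition vector_field U X : Prop :=
  (forall p, U p -> tangent p (X p)) /\
  (forall c, smooth_on (coord c @` (U `&` dom c))
                       (fun x => X (chart_inv c x) c)).

(* X(f) at [p], computed in a chart [c] around [p]. *)
Definition field_deriv c X f p : R :=
  'D_(X p c) (f \o chart_inv c) (coord c p).

(* [X, Y]^k = X^i d_i Y^k - Y^i d_i X^k in every chart. *)
Definition lie_bracket X Y : M -> TM := fun p c =>
  if `[< dom c p >] then
    'D_(X p c) (fun x => Y (chart_inv c x) c) (coord c p)
    - 'D_(Y p c) (fun x => X (chart_inv c x) c) (coord c p)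
  else 0.

(* Nondegenerate of arbitrary signature; for an almost para-Hermitian manifold
   the signature is forced to be neutral by [aph_skew]. *)
Record pseudo_riemannian_metric g : Prop := {
  metric_linear : forall p a u v w, tangent p u -> tangent p v -> tangent p w ->
    g p (a *: u + v) w = a * g p u w + g p v w;
  metric_sym : forall p u v, tangent p u -> tangent p v -> g p u v = g p v u;
  metric_nondegenerate : forall p u, tangent p u ->
    (forall v, tangent p v -> g p u v = 0) -> u = 0;
  metric_smooth : forall U X Y, open U -> vector_field U X -> vector_field U Y ->
    smooth_function U (fun p => g p (X p) (Y p))
}.

Record endomorphism_field J : Prop := {
  endo_tangent : forall p u, tangent p u -> tangent p (J p u);
  endo_linear : forall p a u v, tangent p u -> tangent p v ->
    J p (a *: u + v) = a *: J p u + J p v;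
  endo_smooth : forall U X, open U -> vector_field U X ->
    vector_field U (fun p => J p (X p))
}.

Record almost_para_hermitian g J : Prop := {
  aph_metric : pseudo_riemannian_metric g;
  aph_endo : endomorphism_field J;
  aph_involutive : forall p u, tangent p u -> J p (J p u) = u;
  aph_skew : forall p u v, tangent p u -> tangent p v ->
    g p (J p u) (J p v) = - g p u v
}.

Definition nijenhuis J X Y : M -> TM :=
  let JX := fun p => J p (X p) in
  let JY := fun p => J p (Y p) in
  fun p => lie_bracket X Y p - J p (lie_bracket JX Y p)
           - J p (lie_bracket X JY p) + lie_bracket JX JY p.

Definition integrable_structure J : Prop := forall U X Y,
  open U -> vector_field U X -> vector_field U Y ->
  forall p, U p -> nijenhuis J X Y p = 0.

Definition para_hermitian g J : Prop :=
  almost_para_hermitian g J /\ integrable_structure J.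

(* A connection acts on the vector fields defined on any open subset of M,
   compatibly with restriction ([conn_local]). *)
Record affine_connection nabla : Prop := {
  conn_field : forall U X Y, open U -> vector_field U X -> vector_field U Y ->
    vector_field U (nabla X Y);
  conn_local : forall U X X' Y Y', open U ->
    vector_field U X -> vector_field U Y ->
    (forall p, U p -> X p = X' p) -> (forall p, U p -> Y p = Y' p) ->
    forall p, U p -> nabla X Y p = nabla X' Y' p;
  conn_addl : forall U X X' Y, open U ->
    vector_field U X -> vector_field U X' -> vector_field U Y ->
    forall p, U p -> nabla (X + X') Y p = nabla X Y p + nabla X' Y p;
  conn_scalel : forall U f X Y, open U ->
    smooth_function U f -> vector_field U X -> vector_field U Y ->
    forall p, U p -> nabla (fun q => f q *: X q) Y p = f p *: nabla X Y p;
  conn_addr : forall U X Y Y', open U ->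
    vector_field U X -> vector_field U Y -> vector_field U Y' ->
    forall p, U p -> nabla X (Y + Y') p = nabla X Y p + nabla X Y' p;
  conn_leibniz : forall U f X Y, open U ->
    smooth_function U f -> vector_field U X -> vector_field U Y ->
    forall p c, U p -> dom c p ->
      nabla X (fun q => f q *: Y q) p
      = field_deriv c X f p *: Y p + f p *: nabla X Y p
}.

Record levi_civita_connection g nabla : Prop := {
  lc_connection : affine_connection nabla;
  lc_torsion_free : forall U X Y, open U ->
    vector_field U X -> vector_field U Y ->
    forall p, U p -> nabla X Y p - nabla Y X p = lie_bracket X Y p;
  lc_metric : forall U X Y Z, open U ->
    vector_field U X -> vector_field U Y -> vector_field U Z ->
    forall p c, U p -> dom c p ->
      field_deriv c X (fun q => g q (Y q) (Z q)) p
      = g p (nabla X Y p) (Z p) + g p (Y p) (nabla X Z p)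
}.

Definition curvature_operator nabla X Y Z : M -> TM :=
  nabla X (nabla Y Z) - nabla Y (nabla X Z) - nabla (lie_bracket X Y) Z.

(* [realized_curvature] reads phi^*R_P = A: the curvature is tensorial, so its
   value on tangent vectors at P is computed with any local vector fields
   extending them. *)
Record realization (V : vectType R) (b : V -> V -> R) (JV : V -> V)
    (A : V -> V -> V -> V -> R) g J nabla (P : M) (phi : V -> TM) : Prop := {
  realized_linear : linear phi;
  realized_injective : injective phi;
  realized_range : range phi = tangent P;
  realized_metric : forall x y, g P (phi x) (phi y) = b x y;
  realized_endo : forall x, J P (phi x) = phi (JV x);
  realized_curvature : forall x y z w U X Y Z, open U -> U P ->
    vector_field U X -> vector_field U Y -> vector_field U Z ->
    X P = phi x -> Y P = phi y -> Z P = phi z ->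
    g P (curvature_operator nabla X Y Z P) (phi w) = A x y z w
}.

Definition geometrically_realized (V : vectType R) (b : V -> V -> R)
    (JV : V -> V) (A : V -> V -> V -> V -> R) g J : Prop :=
  exists nabla, levi_civita_connection g nabla /\
  exists (P : M) (phi : V -> TM), realization b JV A g J nabla P phi.

End Geometry.

(* Main.v *)
Require Import Defs.
From HB Require Import structures.
From mathcomp Require Import all_boot all_order all_algebra.
From mathcomp Require Import all_classical all_reals all_analysis.
From mathcomp Require Import ring lra.

Set Implicit Arguments.
Unset Strict Implicit.
Unset Printing Implicit Defensive.

Import Order.TTheory GRing.Theory Num.Theory numFieldNormedType.Exports.
(* From here on [coord] is the coordinate map of a chart, no longer the
   coordinate function of a basis of a vector space. *)
Import Defs.

Local Open Scope classical_set_scope.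
Local Open Scope ring_scope.

(** On four eigenvectors of J with eigenvalues e_1, ..., e_4 = 1 or -1, the
    right-hand side of the para-Gray identity is A(x, y, z, w) times
    1 + e_1 e_2 e_3 e_4 + (the sum of the e_i e_j over i < j). This factor is 8
    if the four eigenvalues agree and 0 otherwise. So the identity says exactly
    that A vanishes on any four vectors of one eigenspace of J ([para_grayP]).

    Necessity. Let D be the bundle of eigenvectors for one eigenvalue. It is
    isotropic, because J reverses the sign of the metric, and in fact D is its
    own orthogonal ([eigen_perp]). It is involutive, because J is integrable
    ([bracket_eigen]). For fields X, Y, Z in D the function g(nabla_X Y, Z) is
    antisymmetric in Y, Z (g vanishes on D) and symmetric in X, Y (the torsion
    is zero and [X, Y] is in D), hence zero. So nabla preserves D
    ([conn_eigen]), the curvature operator of fields in D has values in D, and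
    R(x, y, z, w) = 0 for x, y, z, w in D_P ([curvature_eigen]). Every vector of
    D_P extends to a local field in D ([eigen_extend]).

    Sufficiency. The realization is the coordinate space of dimension 2n with
    the constant structure J, which is integrable, and a metric
        g_p(x, y) = (1 + c(p)) <x, y> + H(p, p; x, y)
    where H is symmetric in its first two and in its last two arguments and
    c vanishes to fourth order at the origin. There the first derivatives of g
    vanish, and the curvature is a combination of its second derivatives
    ([curvature_at_critical_point]), namely
        H(x, z; y, w) + H(y, w; x, z) - H(x, w; y, z) - H(y, z; x, w).
    Two things remain. First, H must make this expression equal to A and
    satisfy H(u, v; Jx, Jy) = - H(u, v; x, y), so that g is compatible with J.
    Such an H is written down on the eigenspaces of J: this is [hess], and
    [hess_curvE] solves the equation, where the vanishing of A on four vectors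
    of one eigenspace is what makes a solution possible. Second, g must be
    nondegenerate on the whole space. This is the purpose of
    c(p) = (k |p|^2)^2: for the Euclidean structure adapted to the signature,
    H(p, p; ., .) is bounded by t = k |p|^2, and 1 + t^2 > t
    ([realizing_mx_unit]).

    The Levi-Civita connection of a metric on coordinate space is
    D_X Y + Gamma(X, Y) with the Christoffel symbols Gamma
    ([christoffel_conn_levi_civita]). In its curvature the second derivatives
    of the vector fields cancel by the symmetry of second derivatives
    ([derive_sym]). *)

(** * Functions of class C^k *)
Section ClassC.
Context {R : realType}.

(** Differentiability at a point depends only on the germ there; this makes
    [class_C] on an open set insensitive to the values outside. *)
Lemma near_eq_differentiable (E F : normedModType R) (f g : E -> F) (x : E) :
  (\near x, f x = g x) -> differentiable f x -> differentiable g x.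
Proof.
move=> fg df.
have fgx : f x = g x by exact: nbhs_singleton fg.
have H : g \o shift x = cst (g x) + 'd f x +o_ 0 id.
  apply/eqaddoP => _/posnumP[e].
  have /eqaddoP/(_ e%:num)/(_ [gt0 of e%:num]) := diff_locally df => dfe.
  have fg' : \forall h \near (0 : E), f (h + x) = g (h + x).
    move: fg => /nbhs_normP[r r0 xr]; apply/nbhs_normP; exists r => // h.
    rewrite /= sub0r normrN => hr; apply: xr.
    by rewrite /= opprD addrCA subrr addr0 normrN.
  near=> h.
  have -> : (g \o shift x - (cst (g x) + 'd f x)) h =
     (f \o shift x - (cst (f x) + 'd f x)) h.
    rewrite /= -![(_ - _ : _ -> _) _]/(_ - _) -![(_ + _ : _ -> _) _]/(_ + _) /=.
    rewrite /cst fgx; congr (_ - _); symmetry; near: h; exact: fg'.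
  by near: h.
have c := diff_continuous df.
apply/diff_locallyP.
have -> : 'd g x = 'd f x :> (E -> F) by exact: diff_unique.
by split.
Unshelve. all: by end_near. Qed.

Lemma class_CS (E F : normedModType R) k (U V : set E) (f : E -> F) :
  V `<=` U -> class_C k U f -> class_C k V f.
Proof.
move=> VU; elim: k f => [|k IH] f /=; first by move=> H x /VU; exact: H.
by move=> [H1 H2]; split=> [x /VU|v]; [exact: H1|exact/IH].
Qed.

Lemma class_C_continuous (E F : normedModType R) k (U : set E) (f : E -> F) x :
  class_C k U f -> U x -> {for x, continuous f}.
Proof.
case: k => [|k] /=; first exact.
by move=> [H _] /H; exact: differentiable_continuous.
Qed.

Lemma class_CW (E F : normedModType R) k (U : set E) (f : E -> F) :
  class_C k.+1 U f -> class_C k U f.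
Proof.
elim: k f => [|k IH] f.
  by move=> H x Ux; exact: (class_C_continuous H).
by move=> [H1 H2]; split=> // v; exact/IH.
Qed.

Lemma class_C_eq (E F : normedModType R) k (U : set E) (f g : E -> F) :
  open U -> (forall x, U x -> f x = g x) -> class_C k U f -> class_C k U g.
Proof.
move=> oU; have nU x : U x -> nbhs x U by move=> Ux; exact: open_nbhs_nbhs.
elim: k f g => [|k IH] f g fg /=.
  move=> H x Ux.
  have n : \near x, f x = g x by apply: filterS (nU _ Ux).
  apply: cvg_trans (near_eq_cvg n) _; rewrite -fg//.
  exact: H.
move=> [H1 H2]; split=> [x Ux|v].
  by apply: near_eq_differentiable (H1 x Ux); apply: filterS (nU _ Ux).
apply: IH (H2 v) => x Ux.
by apply: near_eq_derive; apply: filterS (nU _ Ux).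
Qed.

Lemma class_C_cst (E F : normedModType R) k (U : set E) (a : F) :
  class_C k U (fun=> a).
Proof.
elim: k a => [|k IH] a /=; first by move=> x _; exact: cvg_cst.
split=> [x _|v]; first exact: differentiable_cst.
have -> : (fun x => 'D_v (fun=> a) x) = (fun=> 0 : F).
  by apply/funext => x; exact: derive_cst.
exact: IH.
Qed.

Lemma class_CD (E F : normedModType R) k (U : set E) (f g : E -> F) :
  open U ->
  class_C k U f -> class_C k U g -> class_C k U (fun x => f x + g x).
Proof.
move=> oU; elim: k f g => [|k IH] f g /=.
  by move=> H1 H2 x Ux; apply: cvgD; [exact: H1|exact: H2].
move=> [f1 f2] [g1 g2]; split=> [x Ux|v].
  by apply: differentiableD; [exact: f1|exact: g1].
apply: class_C_eq (IH _ _ (f2 v) (g2 v)) => // x Ux.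
by rewrite -deriveD//; apply: diff_derivable; [exact: f1|exact: g1].
Qed.

Lemma class_CM (E : normedModType R) k (U : set E) (f g : E -> R) :
  open U ->
  class_C k U f -> class_C k U g -> class_C k U (fun x => f x * g x).
Proof.
move=> oU; elim: k f g => [|k IH] f g.
  by move=> H1 H2 x Ux; apply: cvgM; [exact: H1|exact: H2].
move=> Cf Cg; have [f1 f2] := Cf; have [g1 g2] := Cg.
split=> [x Ux|v].
  by apply: differentiableM; [exact: f1|exact: g1].
apply: class_C_eq (class_CD oU (IH _ _ (class_CW Cf) (g2 v))
                    (IH _ _ (class_CW Cg) (f2 v))) => // x Ux.
have df : derivable f x v by apply: diff_derivable; exact: f1.
have dg : derivable g x v by apply: diff_derivable; exact: g1.
by rewrite (deriveM df dg).
Qed.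

Lemma class_CV (E : normedModType R) k (U : set E) (f : E -> R) :
  open U -> (forall x, U x -> f x != 0) ->
  class_C k U f -> class_C k U (fun x => (f x)^-1).
Proof.
move=> oU f0; elim: k => [|k IH].
  by move=> H1 x Ux; apply: cvgV; [exact: f0|exact: H1].
move=> Cf; have [f1 f2] := Cf.
have CV := IH (class_CW Cf).
split=> [x Ux|v].
  by apply: differentiableV; [exact: f1|exact: f0].
pose df x := -1 * ((f x)^-1 * (f x)^-1 * 'D_v f x).
apply: (@class_C_eq _ _ _ _ df _ oU _ _); last first.
  apply: class_CM => //; first exact: class_C_cst.
  by apply: class_CM => //; [exact: class_CM|exact: f2].
move=> x Ux.
have fd : derivable f x v by apply: diff_derivable; exact: f1.
by rewrite /df (deriveV (f0 _ Ux) fd) mulN1r -mulNr -invfM -expr2.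
Qed.

Lemma class_C_sum (E F : normedModType R) k (U : set E) (I : Type) (r : seq I)
    (P : pred I) (f : I -> E -> F) :
  open U -> (forall i, class_C k U (f i)) ->
  class_C k U (fun x => \sum_(i <- r | P i) f i x).
Proof.
move=> oU H; elim: r => [|i r IH].
  by under eq_fun do rewrite big_nil; exact: class_C_cst.
under eq_fun do rewrite big_cons.
by case: (P i) => //; exact: class_CD.
Qed.

Lemma class_C_prod (E : normedModType R) k (U : set E) (I : Type) (r : seq I)
    (P : pred I) (f : I -> E -> R) :
  open U -> (forall i, class_C k U (f i)) ->
  class_C k U (fun x => \prod_(i <- r | P i) f i x).
Proof.
move=> oU H; elim: r => [|i r IH].
  by under eq_fun do rewrite big_nil; exact: class_C_cst.
under eq_fun do rewrite big_cons.
by case: (P i) => //; exact: class_CM.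
Qed.

Lemma differentiable_mx (E : normedModType R) m n (f : E -> 'M[R]_(m, n)) x :
  (forall i j, differentiable (fun y => f y i j) x) -> differentiable f x.
Proof.
move=> H.
have -> : f = \sum_(i < m) \sum_(j < n) (fun y => f y i j *: delta_mx i j).
  apply/funext => y; rewrite fct_sumE [LHS]matrix_sum_delta.
  by apply: eq_bigr => i _; rewrite fct_sumE.
apply: differentiable_sum => i; apply: differentiable_sum => j.
exact: differentiableZl.
Qed.

Lemma differentiable_entry (E : normedModType R) m n (f : E -> 'M[R]_(m, n)) x
  i j : differentiable f x -> differentiable (fun y => f y i j) x.
Proof.
move=> H; have := differentiable_comp H (differentiable_coord (f x) i j).
by [].
Qed.

Lemma derive_entry (E : normedModType R) m n (f : E -> 'M[R]_(m, n)) x v i j :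
  derivable f x v -> 'D_v (fun y => f y i j) x = ('D_v f x) i j.
Proof. by move=> H; rewrite derive_mx// mxE. Qed.

Lemma class_C_mxP (E : normedModType R) m n k (U : set E)
    (f : E -> 'M[R]_(m, n)) : open U ->
  class_C k U f <-> forall i j, class_C k U (fun x => f x i j).
Proof.
move=> oU; elim: k f => [|k IH] f.
  split=> [H i j x Ux|H x Ux].
    have cc : {for f x, continuous (fun M : 'M[R]_(m, n) => M i j : R)}.
      exact/differentiable_continuous/differentiable_coord.
    apply: (@continuous_comp _ _ _ f (fun M : 'M[R]_(m, n) => M i j : R) x).
      exact: H.
    exact: cc.
  move=> A /= [P Pn PA]; apply: filterS PA _.
  have: \forall y \near x, forall ij : 'I_m * 'I_n, P ij.1 ij.2 (f y ij.1 ij.2).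
    apply: filter_forall => -[i j] /=.
    exact: (H i j x Ux _ (Pn i j)).
  by apply: filterS => y Py i j; exact: (Py (i, j)).
split=> [[H1 H2] i j|H].
  split=> [x Ux|v]; first exact/differentiable_entry/H1.
  have /IH/(_ i j) := H2 v; apply: class_C_eq => // x Ux.
  by rewrite derive_entry//; exact/diff_derivable/H1.
have d x : U x -> differentiable f x.
  by move=> Ux; apply: differentiable_mx => i j; exact: (H i j).1.
split=> // v; apply/IH => i j.
apply: class_C_eq ((H i j).2 v) => // x Ux.
by rewrite derive_entry//; exact/diff_derivable/d.
Qed.

Lemma derive_lin (E F : normedModType R) (f : E -> F) x : differentiable f x ->
  linear (fun v => 'D_v f x).
Proof. by move=> df a u v; rewrite !deriveE// linearP. Qed.

Lemma derive_dirB (E F : normedModType R) (f : E -> F) x u v :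
  differentiable f x -> 'D_(u - v) f x = 'D_u f x - 'D_v f x.
Proof.
move=> df; have := derive_lin df (-1) v u.
by rewrite !scaleN1r [- v + u]addrC => ->; exact: addrC.
Qed.
Lemma derive_rV (F : normedModType R) m (f : 'rV[R]_m -> F) x v :
  differentiable f x ->
  'D_v f x = \sum_i v 0 i *: 'D_(delta_mx 0 i) f x.
Proof.
move=> df; rewrite deriveE// {1}(row_sum_delta v) linear_sum.
by apply: eq_bigr => i _; rewrite linearZ/= deriveE.
Qed.

Lemma derive_comp (E : normedModType R) (F : normedModType R) m
    (g : E -> 'rV[R]_m) (f : 'rV[R]_m -> F) x v :
  differentiable g x -> differentiable f (g x) ->
  'D_v (fun y => f (g y)) x = 'D_('D_v g x) f (g x).
Proof.
move=> dg df; rewrite deriveE; last exact: (differentiable_comp dg df).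
by rewrite (diff_comp dg df) /= !deriveE.
Qed.

(** The derivative of a composition is a sum of products of partial derivatives
    of the outer function with components of the derivative of the inner one,
    so closure under products and sums carries the induction. *)
Lemma class_C_comp (E : normedModType R) m k (U : set E) (V : set 'rV[R]_m)
    (g : E -> 'rV[R]_m) (f : 'rV[R]_m -> R) :
  open U -> (forall x, U x -> V (g x)) ->
  class_C k U g -> class_C k V f -> class_C k U (fun x => f (g x)).
Proof.
move=> oU UV; elim: k f => [|k IH] f.
  move=> Cg Cf x Ux; exact: (continuous_comp (Cg x Ux) (Cf _ (UV x Ux))).
move=> Cg Cf; have [g1 g2] := Cg; have [f1 f2] := Cf.
split=> [x Ux|v].
  by apply: (differentiable_comp (g1 x Ux)); exact/f1/UV.
have H : class_C k U (fun x => \sum_i ('D_v g x) 0 i *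
    'D_(delta_mx 0 i) f (g x)).
  apply: class_C_sum => // i; apply: class_CM => //.
    by move: (g2 v) => /class_C_mxP; exact.
  exact: IH (class_CW Cg) (f2 _).
apply: class_C_eq H => // x Ux.
rewrite derive_comp; [|exact: g1|exact/f1/UV].
by rewrite (derive_rV _ (f1 _ (UV _ Ux))).
Qed.

Lemma class_C_derive m k (U : set 'rV[R]_m) (f : 'rV[R]_m -> R)
    (X : 'rV[R]_m -> 'rV[R]_m) :
  open U -> class_C k.+1 U f -> class_C k U X ->
  class_C k U (fun x => 'D_(X x) f x).
Proof.
move=> oU [f1 f2] CX.
have H : class_C k U (fun x => \sum_i X x 0 i * 'D_(delta_mx 0 i) f x).
  apply: class_C_sum => // i; apply: class_CM => //.
    by move/class_C_mxP : CX; exact.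
  exact: f2.
apply: class_C_eq H => // x Ux.
by rewrite (derive_rV _ (f1 _ Ux)).
Qed.

Lemma class_C_comp_mx (E : normedModType R) m n l k (U : set E)
    (V : set 'rV[R]_m) (g : E -> 'rV[R]_m) (f : 'rV[R]_m -> 'M[R]_(n, l)) :
  open U -> open V -> (forall x, U x -> V (g x)) ->
  class_C k U g -> class_C k V f -> class_C k U (fun x => f (g x)).
Proof.
move=> oU oV UV Cg /(class_C_mxP _ _ oV) Cf.
by apply/class_C_mxP => // i j; apply: class_C_comp Cg (Cf i j).
Qed.

Lemma smooth_on_id (E : normedModType R) (U : set E) :
  smooth_on U (id : E -> E).
Proof.
case=> [|k] /=; first by move=> x _; exact: cvg_id.
split=> [x _|v]; first exact: ex_diff.
have -> : (fun x : E => 'D_v id x) = fun=> v.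
  by apply/funext => x; exact: derive_id.
exact: class_C_cst.
Qed.

Lemma smooth_differentiable (E F : normedModType R) (U : set E) (f : E -> F) x :
  smooth_on U f -> U x -> differentiable f x.
Proof. by move=> /(_ 1%N)[H _] /H. Qed.

Lemma smooth_derive (E F : normedModType R) (U : set E) (f : E -> F) v :
  smooth_on U f -> smooth_on U (fun x => 'D_v f x).
Proof. by move=> H k; exact: (H k.+1).2. Qed.

(** The chain rule for a factorization that holds only near the point, as for
    changes of charts. *)
Lemma diff_comp_near (E F G : normedModType R) (f1 : E -> F) (f2 : F -> G)
    (f3 : E -> G) x y a :
  differentiable f1 x -> differentiable f2 y -> f1 x = y ->
  (\forall z \near x, f2 (f1 z) = f3 z) -> 'd f3 x a = 'd f2 y ('d f1 x a).
Proof.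
move=> d1 d2 xy n; rewrite -xy in d2 *.
have d3 := near_eq_differentiable n (differentiable_comp d1 d2).
rewrite -(deriveE _ d3) -(near_eq_derive _ n).
rewrite (deriveE _ (differentiable_comp d1 d2)).
by rewrite (diff_comp d1 d2).
Qed.

End ClassC.

(** * Symmetry of second derivatives *)
Section Schwarz.
Context {R : realType} {E : normedModType R}.

Lemma derive_translate (f : E -> R) (a y v : E) :
  'D_v (fun z => f (z + a)) y = 'D_v f (y + a).
Proof. by rewrite /derive; under eq_fun do rewrite /= -addrA. Qed.

Lemma differentiable_translate (f : E -> R) (a y : E) :
  differentiable f (y + a) -> differentiable (fun z => f (z + a)) y.
Proof. by move=> H; apply: (differentiable_comp (f := fun z => z + a)). Qed.

Lemma MVT_line (g : E -> R) (y u : E) (h : R) : 0 < h ->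
  (forall t, 0 <= t <= h -> differentiable g (y + t *: u)) ->
  exists2 c, 0 <= c <= h & g (y + h *: u) - g y = h * 'D_u g (y + c *: u).
Proof.
move=> h0 dg.
pose line (t : R) := y + t *: u.
have du (t : R) : is_derive t (1 : R) (fun r : R => r *: u) u.
  have [d val] := is_diff_scalel t u.
  apply: DeriveDef; first exact: diff_derivable d.
  by rewrite (deriveE _ d) val scale1r.
have dl (t : R) : is_derive t (1 : R) line u.
  have dy : is_derive t (1 : R) (fun _ : R => y) 0 by exact: is_derive_cst.
  by have := is_deriveD dy (du t); rewrite add0r.
have dline t : differentiable line t.
  by apply/derivable1_diffP; exact: ex_derive.
have D t : 0 <= t <= h -> is_derive t (1 : R) (g \o line) ('D_u g (line t)).
  move=> th; have dgt := dg _ th.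
  apply: DeriveDef.
    by apply: diff_derivable; exact: differentiable_comp.
  rewrite deriveE; last exact: differentiable_comp.
  have lu : 'd line t 1 = u.
    by rewrite -deriveE// (derive_val (is_derive := dl t)).
  by rewrite diff_comp//= lu deriveE.
have [||c cI] := @MVT R (g \o line) (fun t => 'D_u g (line t)) 0 h h0.
- by move=> t; rewrite in_itv /= => /andP[a b]; apply: D; rewrite !ltW.
- apply: continuous_in_subspaceT => t; rewrite inE /= in_itv /= => th.
  apply: differentiable_continuous.
  by apply/derivable1_diffP; case: (D t th).
move=> e; exists c.
  by move: cI; rewrite in_itv /= => /andP[a b]; rewrite !ltW.
by move: e; rewrite /= /line scale0r addr0 subr0 mulrC.
Qed.

(** The mean value theorem is applied twice: along v to the increment of f in
    the direction w, then along w to the derivative of f in the direction v. *)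
Lemma second_difference (U : set E) (f : E -> R) (x v w : E) (h : R) : 0 < h ->
  (forall z, `|z - x| <= h * (`|v| + `|w|) -> U z) -> class_C 2 U f ->
  exists2 z, `|z - x| <= h * (`|v| + `|w|) &
    f (x + h *: v + h *: w) - f (x + h *: v) - f (x + h *: w) + f x =
    h * (h * 'D_w (fun z => 'D_v f z) z).
Proof.
move=> h0 HU [f1 f2].
have N s t : 0 <= s <= h -> 0 <= t <= h ->
    `|x + s *: v + t *: w - x| <= h * (`|v| + `|w|).
  move=> /andP[s0 sh] /andP[t0 th].
  have -> : x + s *: v + t *: w - x = s *: v + t *: w.
    by rewrite -(addrA x) [x + _]addrC addrK.
  rewrite (le_trans (ler_normD _ _))// !normrZ mulrDr.
  by rewrite !ger0_norm//; apply: lerD; apply: ler_wpM2r.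
have hh : 0 <= h <= h by rewrite lexx ltW.
have h00 : 0 <= (0 : R) <= h by rewrite lexx ltW.
pose g := fun z => f (z + h *: w) - f z.
have dT t : 0 <= t <= h ->
    differentiable (fun z => f (z + h *: w)) (x + t *: v).
  by move=> tI; apply: differentiable_translate; apply/f1/HU/N.
have dF t : 0 <= t <= h -> differentiable f (x + t *: v).
  by move=> tI; apply/f1/HU; have := N _ _ tI h00; rewrite scale0r addr0.
have [|c cI ge] := @MVT_line g x v h h0.
  by move=> t tI; apply: differentiableB; [exact: dT|exact: dF].
have gD : 'D_v g (x + c *: v) =
    'D_v f (x + c *: v + h *: w) - 'D_v f (x + c *: v).
  rewrite -(derive_translate f (h *: w)).
  have -> : g = (fun z => f (z + h *: w)) - f by [].
  by apply: deriveB; apply: diff_derivable; [exact: dT|exact: dF].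
have [|d dI ke] := @MVT_line (fun z => 'D_v f z) (x + c *: v) w h h0.
  by move=> t tI; apply: (f2 v).1; exact/HU/N.
exists (x + c *: v + d *: w); first exact: N.
by rewrite -ke -gD -ge /g opprB addrA addrAC.
Qed.

(** The second difference is symmetric in v and w. By [second_difference] it is
    h^2 times either mixed derivative at a point that tends to x with h, and the
    mixed derivatives are continuous. *)
Theorem derive_sym (U : set E) (f : E -> R) (x v w : E) :
  open U -> U x -> class_C 2 U f ->
  'D_w (fun z => 'D_v f z) x = 'D_v (fun z => 'D_w f z) x.
Proof.
move=> oU Ux Cf.
apply/eqP; rewrite -subr_eq0 -normr_le0; apply/ler_addgt0Pl => e e0.
rewrite addr0.
have e2 : 0 < e / 2 by rewrite divr_gt0.
have cvw := (Cf.2 v).2 w x Ux.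
have cwv := (Cf.2 w).2 v x Ux.
have nU : nbhs x U by exact: open_nbhs_nbhs.
move/cvgrPdist_le : cvw => /(_ _ e2) cvw.
move/cvgrPdist_le : cwv => /(_ _ e2) cwv.
have [r r0 Hr] := (@nbhs_normP _ _ _ _).1 (filterI nU (filterI cvw cwv)).
pose N := `|v| + `|w| + 1.
have N0 : 0 < N by rewrite ltr_wpDl// addr_ge0.
(* The increment 1 in N avoids a division by zero when v = w = 0; the factor
   1 / 2 makes the inequality below strict. *)
pose h := r / 2 / N.
have h0 : 0 < h by rewrite !divr_gt0.
have small z : `|z - x| <= h * (`|v| + `|w|) -> `|x - z| < r.
  rewrite distrC => /le_lt_trans; apply.
  have hN : h * N = r / 2 by rewrite /h divfK// gt_eqF.
  have : h * (`|v| + `|w|) <= h * N.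
    by rewrite ler_pM2l// /N lerDl.
  rewrite hN => /le_lt_trans; apply.
  by rewrite ltr_pdivrMr// ltr_pMr// ltr1n.
have H z : `|z - x| <= h * (`|v| + `|w|) -> U z by move=> /small/Hr[].
have [a aI ae] := second_difference h0 H Cf.
have H' z : `|z - x| <= h * (`|w| + `|v|) -> U z.
  by rewrite [`|w| + _]addrC; exact: H.
have [b bI be] := second_difference h0 H' Cf.
have ab : 'D_w (fun z => 'D_v f z) a = 'D_v (fun z => 'D_w f z) b.
  have hn : h != 0 by rewrite gt_eqF.
  apply: (mulfI hn); apply: (mulfI hn); apply: etrans (esym ae) _.
  apply: etrans be; rewrite [x + h *: w + _]addrAC; congr (_ + _).
  exact: addrAC.
have [_ [/= Ha _]] := Hr _ (small _ aI).
rewrite [`|w| + _]addrC in bI.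
have [_ [_ /= Hb]] := Hr _ (small _ bI).
rewrite -(subrKA ('D_w (fun z => 'D_v f z) a)) [e]splitr.
apply: (le_trans (ler_normD _ _)); apply: lerD; first exact: Ha.
by rewrite ab distrC; exact: Hb.
Qed.

End Schwarz.

(** * Tangent vectors and vector fields *)
Section ManifoldBasics.
Context {R : realType} {m : nat} {M : manifold R m}.
Implicit Types (p q : M) (c d e : chart M) (U V : set M).
Local Notation TM := (chart M -> 'rV[R]_m).

Lemma tangentP p a (u v : TM) :
  tangent p u -> tangent p v -> tangent p (a *: u + v).
Proof.
move=> [u0 uJ] [v0 vJ]; split=> [c cp|c d cp dp].
  have -> : (a *: u + v) c = a *: u c + v c by [].
  by rewrite u0// v0// scaler0 addr0.
have -> : (a *: u + v) d = a *: u d + v d by [].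
have -> : (a *: u + v) c = a *: u c + v c by [].
by rewrite (uJ _ _ cp dp) (vJ _ _ cp dp) linearP.
Qed.

Lemma tangent0 p : tangent p (0 : TM).
Proof. by split=> // c d _ _; rewrite linear0. Qed.

Lemma tangentZ p a (u : TM) : tangent p u -> tangent p (a *: u).
Proof.
by move=> H; rewrite -[_ *: _]addr0; apply: tangentP => //; exact: tangent0.
Qed.

Lemma tangentD p (u v : TM) : tangent p u -> tangent p v -> tangent p (u + v).
Proof. by move=> Hu Hv; rewrite -[u]scale1r; exact: tangentP. Qed.

Lemma tangentN p (u : TM) : tangent p u -> tangent p (- u).
Proof. by move=> H; rewrite -scaleN1r; exact: tangentZ. Qed.

Lemma tangentB p (u v : TM) : tangent p u -> tangent p v -> tangent p (u - v).
Proof. by move=> Hu Hv; apply: tangentD => //; exact: tangentN. Qed.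

Lemma coord_image_open c U : open U -> open (coord c @` (U `&` dom c)).
Proof.
move=> oU; rewrite openE => _ [p [Up cp] <-]; rewrite /interior.
have Ip : (coord c @` dom c) (coord c p) by exists p.
have n1 : nbhs (coord c p) (coord c @` dom c).
  by apply: open_nbhs_nbhs; split => //; exact: coord_open.
have n2 : nbhs (coord c p) (chart_inv c @^-1` U).
  apply: (chart_inv_continuous Ip); rewrite coordK//.
  exact: open_nbhs_nbhs.
apply: filterS (filterI n1 n2) => _ [[q cq <-] /= ]; rewrite coordK// => Uq.
by exists q.
Qed.

Lemma near_chart c U p (P : 'rV[R]_m -> Prop) : open U -> U p -> dom c p ->
  (forall q, U q -> dom c q -> P (coord c q)) -> \forall x \near coord c p, P x.
Proof.
move=> oU Up cp H; have := coord_image_open (c := c) oU => oI.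
have : nbhs (coord c p) (coord c @` (U `&` dom c)).
  by apply: open_nbhs_nbhs; split => //; exists p.
by apply: filterS => _ [q [Uq cq] <-]; exact: H.
Qed.

Lemma transition_diff c d p : dom c p -> dom d p ->
  differentiable (coord d \o chart_inv c) (coord c p).
Proof.
move=> cp dp; apply: smooth_differentiable (@transition_smooth _ _ M c d) _.
by exists p.
Qed.

(** The field with constant coordinates [a] in the chart [c]. The value 0
    outside [dom c] keeps it tangent everywhere, but it is smooth only on
    [dom c]. *)
Definition chart_field c (a : 'rV[R]_m) : M -> TM := fun q e =>
  if `[< dom c q /\ dom e q >] then 'd (coord e \o chart_inv c) (coord c q) a
  else 0.

Lemma chart_field_tangent c a q : tangent q (chart_field c a q).
Proof.
split=> [e eq|e d eq dq]; rewrite /chart_field.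
  by case: asboolP => // -[].
case: asboolP => [[cq _]|cq]; case: asboolP => [[cq' _]|cq'] //; first last.
- by rewrite linear0.
- by case: cq.
- by case: cq'.
have D1 := transition_diff cq eq.
have D2 := transition_diff eq dq.
apply: (diff_comp_near _ D1 D2); first by rewrite /= coordK.
apply: (near_chart (dom_open e) eq cq) => q' eq' cq''.
by rewrite /= !coordK.
Qed.

(** In another chart [e] the coordinates of the field are a directional
    derivative of the transition map from [c] to [e], composed with the
    transition map from [e] to [c]. *)
Lemma chart_field_smooth c a : vector_field (dom c) (chart_field c a).
Proof.
split=> [p cp|e]; first exact: chart_field_tangent.
have o1 := coord_image_open (c := e) (@dom_open _ _ M c).
have o2 := coord_image_open (c := c) (@dom_open _ _ M e).
move=> k.
have S1 : class_C k (coord c @` (dom e `&` dom c))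
    (fun x => 'D_a (coord e \o chart_inv c) x).
  apply: smooth_derive; rewrite setIC; exact: transition_smooth.
have S2 : class_C k (coord e @` (dom c `&` dom e)) (coord c \o chart_inv e).
  by rewrite setIC; exact: transition_smooth.
have S3 : forall x, (coord e @` (dom c `&` dom e)) x ->
    (coord c @` (dom e `&` dom c)) ((coord c \o chart_inv e) x).
  by move=> _ [q [cq eq] <-]; exists q => //=; rewrite coordK.
apply: class_C_eq (class_C_comp_mx o1 o2 S3 S2 S1) => //.
move=> _ [q [cq eq] <-] /=; rewrite coordK// /chart_field asboolT//.
by rewrite deriveE//; exact: transition_diff.
Qed.

(** Every tangent vector extends to a local field. *)
Lemma chart_fieldE c v p : dom c p -> tangent p v -> chart_field c (v c) p = v.
Proof.
move=> cp [v0 vJ]; apply/funext => e; rewrite /chart_field.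
case: asboolP => [[_ ep]|ne]; first by rewrite -vJ.
by rewrite v0// => ep; apply: ne.
Qed.

Lemma vector_fieldS U V (X : M -> TM) : V `<=` U -> vector_field U X ->
  vector_field V X.
Proof.
move=> VU [X1 X2]; split=> [p /VU|c k]; first exact: X1.
by apply: class_CS (X2 c k) => _ [p [/VU Up cp] <-]; exists p.
Qed.

Lemma vector_fieldD U (X Y : M -> TM) : open U -> vector_field U X ->
  vector_field U Y -> vector_field U (X + Y).
Proof.
move=> oU [X1 X2] [Y1 Y2]; split=> [p Up|c k].
  by apply: tangentD; [exact: X1|exact: Y1].
by apply: class_CD (X2 c k) (Y2 c k); exact: coord_image_open.
Qed.

Lemma vector_fieldZ U a (X : M -> TM) : open U -> vector_field U X ->
  vector_field U (fun q => a *: X q).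
Proof.
move=> oU [X1 X2]; split=> [p Up|c k].
  by apply: tangentZ; exact: X1.
have oc := coord_image_open (c := c) oU.
apply/class_C_mxP => // i j; under eq_fun do rewrite mxE.
apply: class_CM => //; first exact: class_C_cst.
by have /class_C_mxP := X2 c k; exact.
Qed.

Lemma vector_fieldB U (X Y : M -> TM) : open U -> vector_field U X ->
  vector_field U Y -> vector_field U (X - Y).
Proof.
move=> oU HX HY; have -> : X - Y = X + (fun q => -1 *: Y q).
  by apply/funext => q; congr (_ + _); rewrite scaleN1r.
by apply: vector_fieldD => //; exact: vector_fieldZ.
Qed.

Lemma smooth_function_cst U (a : R) : smooth_function (M := M) U (fun=> a).
Proof. by move=> c k; exact: class_C_cst. Qed.

Lemma field_deriv_cst c X U (f : M -> R) a p : open U -> U p -> dom c p ->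
  (forall q, U q -> f q = a) -> field_deriv c X f p = 0.
Proof.
move=> oU Up cp H; rewrite /field_deriv.
rewrite (@near_eq_derive _ _ _ _ (cst a)); first exact: derive_cst.
apply: (near_chart (U := U)) => // q Uq cq.
by rewrite /= coordK// H.
Qed.

End ManifoldBasics.

(** * The eigenbundles of an integrable para-complex structure *)
Lemma half_double (F : numFieldType) (V : lmodType F) (v : V) :
  2^-1 *: (v + v) = v.
Proof.
by rewrite -[X in X + _]scale1r -[X in _ + X]scale1r -scalerDl scalerA mulVf
  ?scale1r// pnatr_eq0.
Qed.

Section Eigenbundles.
Context {R : realType} {m : nat} {M : manifold R m}.
Local Notation TM := (chart M -> 'rV[R]_m).
Variables (g : M -> TM -> TM -> R) (J : M -> TM -> TM).
Variable (nabla : (M -> TM) -> (M -> TM) -> (M -> TM)).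
Hypothesis hPH : para_hermitian g J.
Hypothesis hLC : levi_civita_connection g nabla.
Implicit Types (p q : M) (c d e : chart M) (U : set M) (X Y Z : M -> TM).

Let hAPH : almost_para_hermitian g J := hPH.1.
Let hg : pseudo_riemannian_metric g := aph_metric hAPH.
Let hJ : endomorphism_field J := aph_endo hAPH.
Let hconn := lc_connection hLC.

Lemma metric_addl p u v w : tangent p u -> tangent p v -> tangent p w ->
  g p (u + v) w = g p u w + g p v w.
Proof.
by move=> hu hv hw; have := metric_linear hg 1 hu hv hw; rewrite scale1r mul1r.
Qed.

Lemma metric_0l p w : tangent p w -> g p 0 w = 0.
Proof.
move=> hw; have := metric_addl (tangent0 p) (tangent0 p) hw; rewrite addr0 => h.
by apply: (addrI (g p 0 w)); rewrite -h addr0.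
Qed.

Lemma metric_scalel p a u w : tangent p u -> tangent p w ->
  g p (a *: u) w = a * g p u w.
Proof.
move=> hu hw; have := metric_linear hg a hu (tangent0 p) hw.
by rewrite addr0 metric_0l// addr0.
Qed.

Lemma metric_subl p u v w : tangent p u -> tangent p v -> tangent p w ->
  g p (u - v) w = g p u w - g p v w.
Proof.
move=> hu hv hw; rewrite -scaleN1r metric_addl//; last exact: tangentZ.
by rewrite metric_scalel// mulN1r.
Qed.

Lemma endo_add p u v :
  tangent p u -> tangent p v -> J p (u + v) = J p u + J p v.
Proof. by move=> hu hv; rewrite -[u]scale1r (endo_linear hJ) // !scale1r. Qed.

Lemma endo_0 p : J p 0 = 0.
Proof.
have := endo_add (tangent0 p) (tangent0 p); rewrite addr0 => h.
by apply: (addrI (J p 0)); rewrite -h addr0.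
Qed.

Lemma endo_scale p a u : tangent p u -> J p (a *: u) = a *: J p u.
Proof.
move=> hu; have := endo_linear hJ a hu (tangent0 p).
by rewrite addr0 endo_0 addr0.
Qed.

Lemma endo_opp p u : tangent p u -> J p (- u) = - J p u.
Proof. by move=> hu; rewrite -scaleN1r endo_scale// scaleN1r. Qed.

Definition eigenvector (eps : R) p (u : TM) :=
  tangent p u /\ J p u = eps *: u.

Definition eigenfield (eps : R) U X :=
  vector_field U X /\ forall p, U p -> J p (X p) = eps *: X p.

Lemma eigenfield_at eps U X p :
  eigenfield eps U X -> U p -> eigenvector eps p (X p).
Proof. by move=> [[h _] h'] Up; split; [exact: h|exact: h']. Qed.

(** Because g(Ju, Jv) = - g(u, v) and eps^2 = 1. *)
Lemma eigen_isotropic eps p u v : eps * eps = 1 ->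
  eigenvector eps p u -> eigenvector eps p v -> g p u v = 0.
Proof.
move=> eps2 [hu Ju] [hv Jv]; have := aph_skew hAPH hu hv; rewrite Ju Jv.
rewrite metric_scalel//; last exact: tangentZ.
rewrite (metric_sym hg)//; last exact: tangentZ.
rewrite metric_scalel// mulrA eps2 mul1r (metric_sym hg)// => h; lra.
Qed.

Variable eps : R.
Hypothesis eps2 : eps * eps = 1.
Local Notation eigvector := (eigenvector eps).
Local Notation eigfield := (eigenfield eps).

(** The component of [u] in the other eigenspace is orthogonal to that other
    eigenspace by isotropy. It is orthogonal to the eigenspace of [eps] because
    both [u] and the other component of [u] are. So it is zero by
    nondegeneracy. *)
Lemma eigen_perp p u : tangent p u ->
  (forall v, eigvector p v -> g p u v = 0) -> J p u = eps *: u.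
Proof.
move=> hu H.
have eps2' : - eps * - eps = 1 by rewrite mulrNN.
have hJu := endo_tangent hJ hu.
(* Up to the factor 2, [u'] is the component of [u] for the eigenvalue - eps;
   [a] and [b] below are the components of [v] for eps and - eps. *)
pose u' := u - eps *: J p u.
have hu' : tangent p u' by apply: tangentB => //; exact: tangentZ.
suff u0 : u' = 0.
  have {2}-> : u = eps *: J p u by apply/eqP; rewrite -subr_eq0 -/u' u0.
  by rewrite scalerA eps2 scale1r.
apply: (metric_nondegenerate hg hu') => v hv.
have hJv := endo_tangent hJ hv.
pose a := v + eps *: J p v; pose b := v - eps *: J p v.
have ha : tangent p a by apply: tangentD => //; exact: tangentZ.
have hb : tangent p b by apply: tangentB => //; exact: tangentZ.
have va : v = 2^-1 *: (a + b).
  by rewrite /a /b addrACA subrr addr0 half_double.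
have Ja : J p a = eps *: a.
  rewrite endo_add//; last exact: tangentZ.
  rewrite endo_scale// (aph_involutive hAPH)// /a scalerDr scalerA eps2 scale1r.
  exact: addrC.
have Jb : J p b = - eps *: b.
  rewrite endo_add//; last exact/tangentN/tangentZ.
  rewrite endo_opp; last exact: tangentZ.
  rewrite endo_scale// (aph_involutive hAPH)// /b scalerBr !scaleNr opprK.
  by rewrite scalerA eps2 scale1r addrC.
have Ju' : J p u' = - eps *: u'.
  rewrite endo_add//; last exact/tangentN/tangentZ.
  rewrite endo_opp; last exact: tangentZ.
  rewrite endo_scale// (aph_involutive hAPH)// /u' scalerBr !scaleNr opprK.
  by rewrite scalerA eps2 scale1r addrC.
have gb : g p b u' = 0 by apply: (eigen_isotropic eps2').
have ga : g p a u' = 0.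
  rewrite (metric_sym hg)// metric_subl//; last exact: tangentZ.
  rewrite H// metric_scalel//.
  have gJ : g p (J p u) a = eps * (g p (J p u) (J p a)).
    rewrite Ja [in RHS](metric_sym hg)//; last exact: tangentZ.
    by rewrite metric_scalel// mulrA eps2 mul1r (metric_sym hg).
  by rewrite gJ (aph_skew hAPH)// H// oppr0 !mulr0 subrr.
rewrite (metric_sym hg)// va metric_scalel//; last exact: tangentD.
by rewrite metric_addl// ga gb addr0 mulr0.
Qed.

(** Project a field with constant coordinates in a chart to the eigenbundle by
    (1 + eps J) / 2. *)
Lemma eigen_extend U p v : open U -> U p -> eigvector p v ->
  exists W X, [/\ open W, W p, W `<=` U, eigfield W X & X p = v].
Proof.
move=> oU Up [hv Jv].
have [c cp] := dom_cover p.
pose X0 := chart_field (M := M) c (v c).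
pose X1 := X0 + (fun q => eps *: J q (X0 q)).
pose X : M -> TM := fun q => 2^-1 *: X1 q.
exists (U `&` dom c), X; split => //.
- by apply: openI => //; exact: dom_open.
- have oc := @dom_open _ _ M c.
  have oI : open (U `&` dom c) by apply: openI.
  have H0 : vector_field (U `&` dom c) X0.
    by apply: vector_fieldS (chart_field_smooth c (v c)) => q [].
  split.
    apply: vector_fieldZ => //; apply: vector_fieldD => //.
    apply: vector_fieldZ => //; exact: (endo_smooth hJ).
  move=> q [Uq cq].
  have t0 : tangent q (X0 q) by exact: H0.1.
  have tJ := endo_tangent hJ t0.
  have t1 : tangent q (X1 q) by apply: tangentD => //; exact: tangentZ.
  rewrite /X endo_scale// scalerA [eps * _]mulrC -scalerA; congr (_ *: _).
  rewrite /X1 -![(_ + _ : M -> TM) q]/(_ + _) endo_add//; last exact: tangentZ.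
  rewrite endo_scale// (aph_involutive hAPH)// scalerDr scalerA eps2 scale1r.
  exact: addrC.
- rewrite /X /X1 -![(_ + _ : M -> TM) p]/(_ + _) /X0 chart_fieldE// Jv.
  by rewrite scalerA eps2 scale1r half_double.
Qed.

Lemma conn_scale_cstl U a X Y p : open U -> U p -> vector_field U X ->
  vector_field U Y -> nabla (fun q => a *: X q) Y p = a *: nabla X Y p.
Proof.
move=> oU Up hX hY.
exact: (conn_scalel hconn oU (smooth_function_cst U a) hX hY).
Qed.

Lemma conn_scale_cstr U a X Y p : open U -> U p -> vector_field U X ->
  vector_field U Y -> nabla X (fun q => a *: Y q) p = a *: nabla X Y p.
Proof.
move=> oU Up hX hY; have [c cp] := dom_cover p.
rewrite (conn_leibniz hconn oU (smooth_function_cst U a) hX hY Up cp).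
by rewrite (field_deriv_cst _ oU Up cp (a := a))// scale0r add0r.
Qed.

(** For JX = eps X and JY = eps Y the Nijenhuis tensor of X and Y is
    2 ([X, Y] - eps J [X, Y]). The brackets with JX and JY are computed from the
    connection, because JX agrees with eps X only on U and a connection is
    local. *)
Lemma bracket_eigen U X Y p : open U -> U p -> eigfield U X ->
  eigfield U Y -> eigvector p (lie_bracket X Y p).
Proof.
move=> oU Up [hX JX] [hY JY].
have tf := lc_torsion_free hLC.
have tB : tangent p (lie_bracket X Y p).
  rewrite -(tf U)//; apply: tangentB.
    by have [h _] := conn_field hconn oU hX hY; exact: h.
  by have [h _] := conn_field hconn oU hY hX; exact: h.
have hJX : vector_field U (fun q => J q (X q)).
  exact: endo_smooth hJ _ _ oU hX.
have hJY : vector_field U (fun q => J q (Y q)).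
  exact: endo_smooth hJ _ _ oU hY.
have hsX := vector_fieldZ eps oU hX.
have hsY := vector_fieldZ eps oU hY.
have e1 : lie_bracket (fun q => J q (X q)) Y p = eps *: lie_bracket X Y p.
  rewrite -!(tf U)//.
  rewrite (conn_local hconn oU hJX hY JX (fun _ _ => erefl))//.
  rewrite (conn_local hconn oU hY hJX (fun _ _ => erefl) JX)//.
  by rewrite (conn_scale_cstl _ oU)// (conn_scale_cstr _ oU)// -scalerBr.
have e2 : lie_bracket X (fun q => J q (Y q)) p = eps *: lie_bracket X Y p.
  rewrite -!(tf U)//.
  rewrite (conn_local hconn oU hJY hX JY (fun _ _ => erefl))//.
  rewrite (conn_local hconn oU hX hJY (fun _ _ => erefl) JY)//.
  by rewrite (conn_scale_cstl _ oU)// (conn_scale_cstr _ oU)// -scalerBr.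
have e3 : lie_bracket (fun q => J q (X q)) (fun q => J q (Y q)) p =
    lie_bracket X Y p.
  rewrite -!(tf U)//.
  rewrite (conn_local hconn oU hJX hJY JX JY)//.
  rewrite (conn_local hconn oU hJY hJX JY JX)//.
  rewrite !(conn_scale_cstl _ oU)// !(conn_scale_cstr _ oU)//.
  by rewrite !scalerA eps2 !scale1r.
have := hPH.2 U X Y oU hX hY p Up; rewrite /nijenhuis e1 e2 e3.
rewrite (endo_scale eps tB); move: tB; set B := lie_bracket X Y p => tB.
rewrite -(addrA B) addrAC -opprD => /eqP; rewrite subr_eq0 => /eqP N.
split; first exact: tB.
have {}N : B = eps *: J p B.
  by rewrite -[LHS]half_double N half_double.
by rewrite [in RHS]N scalerA eps2 scale1r.
Qed.

(** A trilinear expression that is symmetric in the first two arguments and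
    antisymmetric in the last two is zero. *)
Lemma conn_eigen_perp U X Y Z p : open U -> U p ->
  eigfield U X -> eigfield U Y -> eigfield U Z ->
  g p (nabla X Y p) (Z p) = 0.
Proof.
move=> oU Up.
have tn X' Y' : eigfield U X' -> eigfield U Y' -> tangent p (nabla X' Y' p).
  by move=> [hX _] [hY _]; have [h _] := conn_field hconn oU hX hY; exact: h.
pose a X' Y' Z' := g p (nabla X' Y' p) (Z' p).
have as23 X' Y' Z' : eigfield U X' -> eigfield U Y' -> eigfield U Z' ->
    a X' Y' Z' = - a X' Z' Y'.
  move=> hX hY hZ; have [c cp] := dom_cover p.
  have := lc_metric hLC oU hX.1 hY.1 hZ.1 Up cp.
  rewrite (field_deriv_cst _ oU Up cp (a := 0)); last first.
    move=> q Uq; apply: (eigen_isotropic eps2).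
      exact: eigenfield_at hY Uq.
    exact: eigenfield_at hZ Uq.
  rewrite [X in _ + X](metric_sym hg); last 2 first.
  - exact: (eigenfield_at hY Up).1.
  - exact: tn.
  by move=> h; apply/eqP; rewrite -addr_eq0 /a -h.
have s12 X' Y' Z' : eigfield U X' -> eigfield U Y' -> eigfield U Z' ->
    a X' Y' Z' = a Y' X' Z'.
  move=> hX hY hZ; apply/eqP; rewrite -subr_eq0 /a.
  rewrite -metric_subl; [|exact: tn|exact: tn|exact: (eigenfield_at hZ Up).1].
  rewrite (lc_torsion_free hLC oU hX.1 hY.1)//; apply/eqP.
  apply: (eigen_isotropic eps2); first exact: bracket_eigen hX hY.
  exact: eigenfield_at hZ Up.
move=> hX hY hZ; rewrite -/(a X Y Z).
have : a X Y Z = - a X Y Z.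
  rewrite {1}s12// as23// s12// as23// opprK s12// as23//.
by move=> h; lra.
Qed.

Lemma conn_eigen U X Y : open U -> eigfield U X -> eigfield U Y ->
  eigfield U (nabla X Y).
Proof.
move=> oU hX hY; have hN := conn_field hconn oU hX.1 hY.1.
split=> // p Up; apply: eigen_perp; first exact: hN.1.
move=> v /(eigen_extend oU Up)[W [Z [oW Wp WU hZ <-]]].
apply: (conn_eigen_perp oW Wp) => //.
  by split=> [|q /WU]; [exact: vector_fieldS WU hX.1|exact: hX.2].
by split=> [|q /WU]; [exact: vector_fieldS WU hY.1|exact: hY.2].
Qed.

Lemma eigenfieldS U V X : V `<=` U -> eigfield U X -> eigfield V X.
Proof.
move=> VU [h1 h2]; split; first exact: vector_fieldS h1.
by move=> q /VU; exact: h2.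
Qed.

(** [nabla] is applied to [nabla X Y - nabla Y X] in place of [lie_bracket X Y]:
    the two fields agree on U only, which locality of the connection allows. *)
Lemma curvature_eigen U X Y Z p w : open U -> U p ->
  eigfield U X -> eigfield U Y -> eigfield U Z -> eigvector p w ->
  g p (curvature_operator nabla X Y Z p) w = 0.
Proof.
move=> oU Up hX hY hZ hw.
have h1 := conn_eigen oU hX (conn_eigen oU hY hZ).
have h2 := conn_eigen oU hY (conn_eigen oU hX hZ).
have hXY := conn_eigen oU hX hY.
have hYX := conn_eigen oU hY hX.
pose B := nabla X Y - nabla Y X.
have hB : eigfield U B.
  split; first exact: vector_fieldB hXY.1 hYX.1.
  move=> q Uq; rewrite /B -![(_ - _ : M -> TM) q]/(_ - _).
  have tX := (eigenfield_at hXY Uq).1; have tY := (eigenfield_at hYX Uq).1.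
  rewrite endo_add//; last exact: tangentN.
  by rewrite endo_opp// hXY.2// hYX.2// scalerBr.
have h3 := conn_eigen oU hB hZ.
have e3 : nabla (lie_bracket X Y) Z p = nabla B Z p.
  symmetry; apply: (conn_local hconn oU hB.1 hZ.1) => // q Uq.
  exact: (lc_torsion_free hLC oU hX.1 hY.1 Uq).
rewrite /curvature_operator -![(_ - _ : M -> TM) p]/(_ - _) e3.
have t1 := eigenfield_at h1 Up; have t2 := eigenfield_at h2 Up.
have t3 := eigenfield_at h3 Up.
have t12 := tangentB t1.1 t2.1.
rewrite metric_subl //; [|exact: t3.1|exact: hw.1].
rewrite metric_subl //; [|exact: t1.1|exact: t2.1|exact: hw.1].
by rewrite !(eigen_isotropic eps2)// !subrr.
Qed.

End Eigenbundles.

(** * The para-Gray identity on eigenvectors *)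
Section CurvatureAlgebra.
Context {R : realType} {V : vectType R}.
Variables (A : V -> V -> V -> V -> R) (J : V -> V).
Hypothesis hA : algebraic_curvature_tensor A.
Hypothesis Jlin : linear J.
Hypothesis JJ : forall x, J (J x) = x.

Lemma actD1 x x' y z w : A (x + x') y z w = A x y z w + A x' y z w.
Proof. by have := act_linear1 hA y z w 1 x x'; rewrite scale1r mul1r. Qed.
Lemma actD2 x y y' z w : A x (y + y') z w = A x y z w + A x y' z w.
Proof. by have := act_linear2 hA x z w 1 y y'; rewrite scale1r mul1r. Qed.
Lemma actD3 x y z z' w : A x y (z + z') w = A x y z w + A x y z' w.
Proof. by have := act_linear3 hA x y w 1 z z'; rewrite scale1r mul1r. Qed.
Lemma actD4 x y z w w' : A x y z (w + w') = A x y z w + A x y z w'.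
Proof. by have := act_linear4 hA x y z 1 w w'; rewrite scale1r mul1r. Qed.

Lemma act01 y z w : A 0 y z w = 0.
Proof. by apply: (addrI (A 0 y z w)); rewrite -actD1 !addr0. Qed.
Lemma act02 x z w : A x 0 z w = 0.
Proof. by apply: (addrI (A x 0 z w)); rewrite -actD2 !addr0. Qed.
Lemma act03 x y w : A x y 0 w = 0.
Proof. by apply: (addrI (A x y 0 w)); rewrite -actD3 !addr0. Qed.
Lemma act04 x y z : A x y z 0 = 0.
Proof. by apply: (addrI (A x y z 0)); rewrite -actD4 !addr0. Qed.

Lemma actZ1 a x y z w : A (a *: x) y z w = a * A x y z w.
Proof. by have := act_linear1 hA y z w a x 0; rewrite act01 !addr0. Qed.
Lemma actZ2 a x y z w : A x (a *: y) z w = a * A x y z w.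
Proof. by have := act_linear2 hA x z w a y 0; rewrite act02 !addr0. Qed.
Lemma actZ3 a x y z w : A x y (a *: z) w = a * A x y z w.
Proof. by have := act_linear3 hA x y w a z 0; rewrite act03 !addr0. Qed.
Lemma actZ4 a x y z w : A x y z (a *: w) = a * A x y z w.
Proof. by have := act_linear4 hA x y z a w 0; rewrite act04 !addr0. Qed.

Lemma lin_add x y : J (x + y) = J x + J y.
Proof. by have := Jlin 1 x y; rewrite !scale1r. Qed.
Lemma lin_0 : J 0 = 0.
Proof. by apply: (addrI (J 0)); rewrite -lin_add !addr0. Qed.
Lemma lin_scale a x : J (a *: x) = a *: J x.
Proof. by have := Jlin a x 0; rewrite lin_0 !addr0. Qed.

Definition eigen_vanishing := forall eps x y z w, eps * eps = 1 ->
  J x = eps *: x -> J y = eps *: y -> J z = eps *: z -> J w = eps *: w ->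
  A x y z w = 0.

(** For the converse, expand A on the vectors u + Ju, and on the vectors
    u - Ju. In the sum of the two expansions the terms with an odd number of
    occurrences of J cancel, and the others form twice the identity. *)
Lemma para_grayP : para_gray_identity J A <-> eigen_vanishing.
Proof.
split=> [G e x y z w e2 hx hy hz hw|H x y z w].
  have := G x y z w; rewrite hx hy hz hw.
  rewrite !(actZ1, actZ2, actZ3, actZ4).
  have : (e - 1) * (e + 1) = 0 by rewrite mulrDr mulr1 mulrBl e2; ring.
  move/eqP; rewrite mulf_eq0 subr_eq0 addr_eq0 => /orP[|] /eqP->.
    by rewrite !mul1r => h; lra.
  by rewrite !mulN1r !opprK => h; lra.
have E e u : e * e = 1 -> J (u + e *: J u) = e *: (u + e *: J u).
  move=> e2; rewrite lin_add lin_scale JJ scalerDr scalerA e2 scale1r.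
  exact: addrC.
have h1 : 1 * 1 = 1 :> R by rewrite mulr1.
have h2 : -1 * -1 = 1 :> R by rewrite mulrNN mulr1.
have := H _ _ _ _ _ h1 (E _ x h1) (E _ y h1) (E _ z h1) (E _ w h1).
have := H _ _ _ _ _ h2 (E _ x h2) (E _ y h2) (E _ z h2) (E _ w h2).
rewrite !(actD1, actD2, actD3, actD4, actZ1, actZ2, actZ3, actZ4).
move=> e1 e2; lra.
Qed.

End CurvatureAlgebra.

Section Forward.
Context {R : realType} {m : nat} {M : manifold R m} {V : vectType R}.
Local Notation TM := (chart M -> 'rV[R]_m).

Theorem realized_para_gray (b : V -> V -> R) (J : V -> V)
    (A : V -> V -> V -> V -> R) (g : M -> TM -> TM -> R) (JM : M -> TM -> TM) :
  algebraic_curvature_tensor A -> linear J -> (forall x, J (J x) = x) ->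
  para_hermitian g JM -> geometrically_realized b J A g JM ->
  para_gray_identity J A.
Proof.
move=> hA Jlin JJ hPH [nabla [hLC [P [phi hR]]]].
apply/para_grayP => // e x y z w e2 hx hy hz hw.
have plin := realized_linear hR.
have p0 : phi 0 = 0.
  by have := plin 1 0 0; rewrite !scale1r addr0 -{1}[phi 0]addr0 => /addrI.
have eig u : J u = e *: u -> eigenvector JM e P (phi u).
  move=> hu; split; first by rewrite -(realized_range hR); exists u.
  by rewrite (realized_endo hR) hu; have := plin e u 0; rewrite p0 !addr0.
have [U1 [X [oU1 PU1 _ hX eX]]] := eigen_extend hPH e2 openT I (eig _ hx).
have [U2 [Y [oU2 PU2 U21 hY eY]]] := eigen_extend hPH e2 oU1 PU1 (eig _ hy).
have [U3 [Z [oU3 PU3 U32 hZ eZ]]] := eigen_extend hPH e2 oU2 PU2 (eig _ hz).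
have hX3 : eigenfield JM e U3 X by apply: eigenfieldS hX => q /U32/U21.
have hY3 : eigenfield JM e U3 Y by apply: eigenfieldS hY => q /U32.
rewrite -(realized_curvature hR w oU3 PU3 hX3.1 hY3.1 hZ.1 eX eY eZ).
exact: (curvature_eigen hPH hLC e2 oU3 PU3 hX3 hY3 hZ (eig _ hw)).
Qed.
End Forward.

(** * Calculus of matrix-valued functions *)
Section MatrixCalculus.
Context {R : realType}.

Definition bilin m (S : 'M[R]_m) (u v : 'rV[R]_m) : R := (u *m S *m v^T) 0 0.

Lemma bilinE m (S : 'M[R]_m) u v :
  bilin S u v = \sum_i \sum_j S i j * (u 0 i * v 0 j).
Proof.
rewrite /bilin mxE exchange_big /=; apply: eq_bigr => j _.
rewrite !mxE mulr_suml; apply: eq_bigr => i _; ring.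
Qed.

Lemma bilinDl m (S : 'M[R]_m) u u' v :
  bilin S (u + u') v = bilin S u v + bilin S u' v.
Proof. by rewrite /bilin !mulmxDl mxE. Qed.
Lemma bilinDr m (S : 'M[R]_m) u v v' :
  bilin S u (v + v') = bilin S u v + bilin S u v'.
Proof. by rewrite /bilin linearD mulmxDr mxE. Qed.
Lemma bilinZl m (S : 'M[R]_m) a u v : bilin S (a *: u) v = a * bilin S u v.
Proof. by rewrite /bilin -!scalemxAl mxE. Qed.
Lemma bilinZr m (S : 'M[R]_m) a u v : bilin S u (a *: v) = a * bilin S u v.
Proof. by rewrite /bilin linearZ -scalemxAr mxE. Qed.
Lemma bilinD m (S T : 'M[R]_m) u v :
  bilin (S + T) u v = bilin S u v + bilin T u v.
Proof. by rewrite /bilin mulmxDr mulmxDl mxE. Qed.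
Lemma bilinZ m a (S : 'M[R]_m) u v : bilin (a *: S) u v = a * bilin S u v.
Proof. by rewrite /bilin -scalemxAr -scalemxAl mxE. Qed.
Lemma bilin0l m (S : 'M[R]_m) v : bilin S 0 v = 0.
Proof. by rewrite /bilin !mul0mx mxE. Qed.
Lemma bilin0r m (S : 'M[R]_m) v : bilin S v 0 = 0.
Proof. by rewrite /bilin linear0 mulmx0 mxE. Qed.
Lemma bilin0 m (u v : 'rV[R]_m) : bilin 0 u v = 0.
Proof. by rewrite /bilin mulmx0 mul0mx mxE. Qed.
Lemma bilinNl m (S : 'M[R]_m) u v : bilin S (- u) v = - bilin S u v.
Proof. by rewrite -scaleN1r bilinZl mulN1r. Qed.
Lemma bilinT m (S : 'M[R]_m) u v : bilin S^T u v = bilin S v u.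
Proof.
rewrite !bilinE exchange_big /=; apply: eq_bigr => i _.
by apply: eq_bigr => j _; rewrite mxE; ring.
Qed.
Lemma bilin_delta_r m (S : 'M[R]_m) u j :
  bilin S u (delta_mx 0 j) = (u *m S) 0 j.
Proof. by rewrite /bilin trmx_delta -colE !mxE. Qed.

Lemma is_derive_bigsum (E F : normedModType R) (I : Type) (r : seq I)
    (f : I -> E -> F) (df : I -> F) (x v : E) :
  (forall i, is_derive x v (f i) (df i)) ->
  is_derive x v (fun y => \sum_(i <- r) f i y) (\sum_(i <- r) df i).
Proof.
move=> H; elim: r => [|i r IH].
  rewrite big_nil; under eq_fun do rewrite big_nil.
  exact: is_derive_cst.
rewrite big_cons; under eq_fun do rewrite big_cons.
exact: (is_deriveD (H i) IH).
Qed.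

Lemma differentiable_is_derive (E F : normedModType R) (f : E -> F) x v :
  differentiable f x -> is_derive x v f ('D_v f x).
Proof. by move=> H; apply: DeriveDef => //; exact: diff_derivable. Qed.

Lemma derive_bilin (E : normedModType R) m (F : E -> 'M[R]_m)
    (Y Z : E -> 'rV[R]_m) x v :
  differentiable F x -> differentiable Y x -> differentiable Z x ->
  'D_v (fun q => bilin (F q) (Y q) (Z q)) x =
  bilin ('D_v F x) (Y x) (Z x) + bilin (F x) ('D_v Y x) (Z x)
  + bilin (F x) (Y x) ('D_v Z x).
Proof.
move=> dF dY dZ; under eq_fun do rewrite bilinE.
rewrite !bilinE -!big_split /=.
have dF' i j : is_derive x v (fun q => F q i j) ('D_v F x i j).
  rewrite -(derive_entry i j (diff_derivable (v := v) dF)).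
  exact/differentiable_is_derive/differentiable_entry.
have dY' j : is_derive x v (fun q => Y q 0 j) ('D_v Y x 0 j).
  rewrite -(derive_entry 0 j (diff_derivable (v := v) dY)).
  exact/differentiable_is_derive/differentiable_entry.
have dZ' j : is_derive x v (fun q => Z q 0 j) ('D_v Z x 0 j).
  rewrite -(derive_entry 0 j (diff_derivable (v := v) dZ)).
  exact/differentiable_is_derive/differentiable_entry.
set rhs := (RHS).
suff : is_derive x v (fun q => \sum_i \sum_j F q i j * (Y q 0 i * Z q 0 j)) rhs.
  by case.
apply: is_derive_bigsum => i; rewrite -!big_split /=.
apply: is_derive_bigsum => j.
have H := is_deriveM (dF' i j) (is_deriveM (dY' i) (dZ' j)).
apply: is_derive_eq.
rewrite -[X in _ + X *: _]/(Y x 0 i * Z x 0 j) /GRing.scale /=; ring.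
Qed.

Lemma differentiable_bilin (E : normedModType R) m (F : E -> 'M[R]_m)
    (Y Z : E -> 'rV[R]_m) x :
  differentiable F x -> differentiable Y x -> differentiable Z x ->
  differentiable (fun q => bilin (F q) (Y q) (Z q)) x.
Proof.
move=> dF dY dZ.
have -> : (fun q => bilin (F q) (Y q) (Z q)) =
    \sum_i \sum_j (fun q => F q i j * (Y q 0 i * Z q 0 j)).
  apply/funext => q; rewrite bilinE fct_sumE; apply: eq_bigr => i _.
  by rewrite fct_sumE.
apply: differentiable_sum => i; apply: differentiable_sum => j.
apply: differentiableM; first exact: differentiable_entry.
by apply: differentiableM; exact: differentiable_entry.
Qed.

Lemma derive_trmx (E : normedModType R) m (F : E -> 'M[R]_m) x v :
  differentiable F x -> (forall q, (F q)^T = F q) -> ('D_v F x)^T = 'D_v F x.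
Proof.
move=> dF sF; apply/matrixP => i j; rewrite mxE.
have d : derivable F x v by apply: diff_derivable; exact: dF.
rewrite -!(derive_entry _ _ d); congr ('D_v _ x); apply/funext => q.
by rewrite -[in LHS]sF mxE.
Qed.

Lemma derive_scalemx (E : normedModType R) k l (a : E -> R)
    (F : E -> 'M[R]_(k, l)) x v :
  differentiable a x -> differentiable F x ->
  'D_v (fun q => a q *: F q) x = 'D_v a x *: F x + a x *: 'D_v F x.
Proof.
move=> da dF.
have dF' i j : differentiable (fun q => F q i j) x.
  exact: differentiable_entry.
have dd i j : derivable (fun q => (a q *: F q) i j) x v.
  under eq_fun do rewrite mxE.
  by apply: diff_derivable; apply: differentiableM.
rewrite derive_mx; last by apply/derivable_mxP.
apply/matrixP => i j; rewrite !mxE.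
under eq_fun do rewrite mxE.
have dav : derivable a x v by exact: diff_derivable.
have dFv : derivable (fun q => F q i j) x v by exact: diff_derivable.
rewrite (deriveM dav dFv).
rewrite (derive_entry i j (diff_derivable (v := v) dF)).
by rewrite -![_ *: _]/(_ * _) addrC [F x i j * _]mulrC.
Qed.

Lemma differentiable_scalemx (E : normedModType R) k l (a : E -> R)
    (F : E -> 'M[R]_(k, l)) x :
  differentiable a x -> differentiable F x ->
  differentiable (fun q => a q *: F q) x.
Proof.
move=> da dF; apply: differentiable_mx => i j.
under eq_fun do rewrite mxE.
by apply: differentiableM => //; exact: differentiable_entry.
Qed.

Lemma class_C_bilin (E : normedModType R) m k (U : set E) (F : E -> 'M[R]_m)
    (Y Z : E -> 'rV[R]_m) : open U ->
  class_C k U F -> class_C k U Y -> class_C k U Z ->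
  class_C k U (fun q => bilin (F q) (Y q) (Z q)).
Proof.
move=> oU /(class_C_mxP _ _ oU) cF.
move=> /(class_C_mxP _ _ oU) cY /(class_C_mxP _ _ oU) cZ.
under eq_fun do rewrite bilinE.
apply: class_C_sum => // i; apply: class_C_sum => // j.
apply: class_CM => //; exact: class_CM.
Qed.

Lemma class_C_det (E : normedModType R) n k (U : set E) (F : E -> 'M[R]_n) :
  open U -> (forall i j, class_C k U (fun q => F q i j)) ->
  class_C k U (fun q => \det (F q)).
Proof.
move=> oU cF; apply: class_C_sum => // s; apply: class_CM => //.
  exact: class_C_cst.
by apply: class_C_prod.
Qed.

(** By Cramer's rule. *)
Lemma class_C_invmx (E : normedModType R) n k (U : set E) (F : E -> 'M[R]_n) :
  open U -> (forall q, U q -> F q \in unitmx) -> class_C k U F ->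
  class_C k U (fun q => invmx (F q)).
Proof.
move=> oU uF /(class_C_mxP _ _ oU) cF.
apply/class_C_mxP => // i j.
pose cramer q := (\det (F q))^-1 * \adj (F q) i j.
apply: (@class_C_eq _ _ _ _ _ cramer) => //; rewrite /cramer.
  by move=> q Uq; rewrite /invmx uF// [in RHS]mxE.
apply: class_CM => //.
  apply: class_CV => //; last exact: class_C_det.
  by move=> q /uF; rewrite unitmxE unitfE.
under eq_fun do rewrite mxE.
rewrite /cofactor; apply: class_CM => //; first exact: class_C_cst.
apply: class_C_det => // i' j'; under eq_fun do rewrite !mxE.
exact: cF.
Qed.

Lemma class_C_mulmx (E : normedModType R) a b c k (U : set E)
    (F : E -> 'M[R]_(a, b)) (G : E -> 'M[R]_(b, c)) :
  open U -> class_C k U F -> class_C k U G ->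
  class_C k U (fun q => F q *m G q).
Proof.
move=> oU /(class_C_mxP _ _ oU) cF /(class_C_mxP _ _ oU) cG.
apply/class_C_mxP => // i j; under eq_fun do rewrite mxE.
by apply: class_C_sum => // l; exact: class_CM.
Qed.

Lemma class_C_derive_mx m a b k (U : set 'rV[R]_m)
    (f : 'rV[R]_m -> 'M[R]_(a, b)) (X : 'rV[R]_m -> 'rV[R]_m) :
  open U -> class_C k.+1 U f -> class_C k U X ->
  class_C k U (fun x => 'D_(X x) f x).
Proof.
move=> oU cf cX; apply/class_C_mxP => // i j.
have cfe := (class_C_mxP _ _ oU).1 cf i j.
apply: class_C_eq (class_C_derive oU cfe cX) => // x Ux.
by rewrite derive_entry//; apply: diff_derivable; exact: cf.1.
Qed.

(** The second derivative of F along a field splits into the derivative of the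
    field and the Hessian of F. *)
Lemma derive_along_field m a b (U : set 'rV[R]_m) (F : 'rV[R]_m -> 'M[R]_(a, b))
    (Y : 'rV[R]_m -> 'rV[R]_m) x v :
  open U -> U x -> class_C 2 U F -> differentiable Y x ->
  'D_v (fun q => 'D_(Y q) F q) x =
  'D_('D_v Y x) F x + 'D_v (fun q => 'D_(Y x) F q) x.
Proof.
move=> oU Ux cF dY.
have nU : \near x, U x by exact: open_nbhs_nbhs.
pose e i : 'rV[R]_m := delta_mx 0 i.
have dF q : U q -> differentiable F q by exact: cF.1.
have ddF i : differentiable (fun q => 'D_(e i) F q) x by exact: (cF.2 (e i)).1.
have n1 : \forall q \near x, 'D_(Y q) F q = \sum_i Y q 0 i *: 'D_(e i) F q.
  by apply: filterS nU => q Uq; rewrite derive_rV//; exact: dF.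
have n2 : \forall q \near x, 'D_(Y x) F q = \sum_i Y x 0 i *: 'D_(e i) F q.
  by apply: filterS nU => q Uq; rewrite derive_rV//; exact: dF.
have dYi i : differentiable (fun q => Y q 0 i) x by exact: differentiable_entry.
have H1 : is_derive x v (fun q => \sum_i Y q 0 i *: 'D_(e i) F q)
   (\sum_i ('D_v Y x 0 i *: 'D_(e i) F x +
            Y x 0 i *: 'D_v (fun q => 'D_(e i) F q) x)).
  apply: is_derive_bigsum => i.
  rewrite -(derive_entry 0 i (diff_derivable (v := v) dY)).
  rewrite -(derive_scalemx v (dYi i) (ddF i)).
  apply: differentiable_is_derive.
  exact: (differentiable_scalemx (dYi i) (ddF i)).
have H2 : is_derive x v (fun q => \sum_i Y x 0 i *: 'D_(e i) F q)
   (\sum_i (Y x 0 i *: 'D_v (fun q => 'D_(e i) F q) x)).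
  apply: is_derive_bigsum => i.
  apply: is_deriveZ.
  exact: differentiable_is_derive.
apply: etrans (near_eq_derive v n1) _.
apply: etrans (derive_val (is_derive := H1)) _.
rewrite (etrans (near_eq_derive v n2) (derive_val (is_derive := H2))).
rewrite big_split /=; congr (_ + _).
by rewrite [RHS](derive_rV _ (dF x Ux)).
Qed.

Lemma derive_sym_mx m a b (U : set 'rV[R]_m) (F : 'rV[R]_m -> 'M[R]_(a, b))
    x v w : open U -> U x -> class_C 2 U F ->
  'D_w (fun q => 'D_v F q) x = 'D_v (fun q => 'D_w F q) x.
Proof.
move=> oU Ux cF; apply/matrixP => i j.
have nU : \near x, U x by exact: open_nbhs_nbhs.
have cFij := (class_C_mxP _ _ oU).1 cF i j.
have E u t : ('D_u (fun q => 'D_t F q) x) i j =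
    'D_u (fun q => 'D_t (fun z => F z i j) q) x.
  rewrite -derive_entry; last by apply: diff_derivable; exact: (cF.2 t).1.
  apply: near_eq_derive; apply: filterS nU => q Uq.
  by rewrite derive_entry//; apply: diff_derivable; exact: cF.1.
exact: etrans (E w v) (etrans (derive_sym v w oU Ux cFij) (esym (E v w))).
Qed.

Lemma derive_quad m (S : 'M[R]_m) u q :
  is_derive q u (fun x => bilin S x x) (bilin S u q + bilin S q u).
Proof.
have dS : differentiable (fun _ : 'rV[R]_m => S) q by exact: differentiable_cst.
have di : differentiable (id : 'rV[R]_m -> 'rV[R]_m) q by exact: ex_diff.
have := derive_bilin u dS di di.
rewrite derive_cst bilin0 add0r !derive_id => <-.
exact/differentiable_is_derive/(differentiable_bilin dS di di).
Qed.

(** Differentiates the result of [derive_quad] once more. *)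
Lemma derive_polar m (S : 'M[R]_m) v u q :
  is_derive q u (fun x => bilin S v x + bilin S x v)
    (bilin S v u + bilin S u v).
Proof.
have dS : differentiable (fun _ : 'rV[R]_m => S) q by exact: differentiable_cst.
have dv : differentiable (fun _ : 'rV[R]_m => v) q by exact: differentiable_cst.
have di : differentiable (id : 'rV[R]_m -> 'rV[R]_m) q by exact: ex_diff.
have H1 := derive_bilin u dS di dv; have H2 := derive_bilin u dS dv di.
rewrite !derive_cst derive_id bilin0 add0r bilin0r addr0 in H1.
rewrite !derive_cst derive_id bilin0 add0r bilin0l add0r in H2.
rewrite -H1 -H2.
exact: (is_deriveD
  (differentiable_is_derive u (differentiable_bilin dS dv di))
  (differentiable_is_derive u (differentiable_bilin dS di dv))).
Qed.

Lemma derive_mulmx_cst m (E : normedModType R) (Y : E -> 'rV[R]_m)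
    (S : 'M[R]_m) p u :
  differentiable Y p -> 'D_u (fun q => Y q *m S) p = 'D_u Y p *m S.
Proof.
move=> dY.
have dS : differentiable (fun _ : E => S) p by exact: differentiable_cst.
have dd k : differentiable (fun _ : E => delta_mx 0 k : 'rV[R]_m) p.
  exact: differentiable_cst.
have ent k :
    (fun q => (Y q *m S) 0 k) = (fun q => bilin S (Y q) (delta_mx 0 k)).
  by apply/funext => q; rewrite bilin_delta_r.
have dYS : differentiable (fun q => Y q *m S) p.
  apply: differentiable_mx => i k; rewrite ord1 ent.
  exact: differentiable_bilin.
apply/rowP => k; rewrite -(derive_entry 0 k (diff_derivable dYS)) ent.
rewrite (derive_bilin u dS dY (dd k)) !derive_cst bilin0 bilin0r add0r addr0.
by rewrite bilin_delta_r.
Qed.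

End MatrixCalculus.

(** * Coordinate space as a manifold *)
Section EuclideanManifold.
Context {R : realType} (m : nat).

Lemma rV_second_countable : @second_countable 'rV[R]_m.
Proof.
pose f (a : 'rV[rat]_m * nat) : set 'rV[R]_m :=
  ball (map_mx ratr a.1 : 'rV[R]_m) (a.2.+1%:R^-1 : R).
exists (range f).
  exact: sub_countable (card_image_le f setT) (countableP _).
split; first by move=> _ [a _ <-]; exact: ball_open.
move=> x V /nbhs_ballP[e /= e0 xeV].
have [N] := @ltr_add_invr R 0 (e / 2) (divr_gt0 e0 (ltr0n _ 2)).
rewrite add0r => Ne.
have N0 : (0 : R) < N.+1%:R^-1 by rewrite invr_gt0 ltr0n.
have H i : exists q : rat, `|x 0 i - ratr q| < N.+1%:R^-1.
  have : x 0 i < x 0 i + N.+1%:R^-1 by rewrite ltrDl.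
  move=> /rat_in_itvoo[q]; rewrite in_itv /= => /andP[q1 q2]; exists q.
  by rewrite distrC ger0_norm ?subr_ge0 1?ltW// ltrBlDl.
pose q := \row_i projT1 (cid (H i)).
have xq : ball (map_mx ratr q : 'rV[R]_m) N.+1%:R^-1 x.
  split=> // i j; rewrite ord1 !mxE; apply: ball_sym.
  by case: cid.
exists (f (q, N)); first by split => //; exists (q, N).
move=> y yq; apply: xeV.
rewrite [e]splitr; apply: (@ball_triangle _ _ (map_mx ratr q : 'rV[R]_m)).
  by apply: (le_ball (ltW Ne)); exact: ball_sym.
exact: (le_ball (ltW Ne)).
Qed.

(** Transparent, so that its points are row vectors and its only chart is
    [tt], by conversion. *)
Definition euclidean : manifold R m.
Proof.
refine (@Manifold R m 'rV[R]_m unit (fun=> setT) (fun=> id) (fun=> id)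
  (@norm_hausdorff _ _) rV_second_countable (fun=> openT)
  (fun p => ex_intro _ tt I) _ (fun _ _ _ => erefl) _ _ _).
- by move=> _; rewrite image_id; exact: openT.
- by move=> _ p _; exact: cvg_id.
- by move=> _ p _; exact: cvg_id.
- by move=> _ _; exact: smooth_on_id.
Defined.

End EuclideanManifold.

Section EuclideanFields.
Context {R : realType} {m : nat}.
Local Notation E := (euclidean (R := R) m).
Local Notation TM := (chart E -> 'rV[R]_m).
Implicit Types (X Y Z : E -> TM) (U : set E).

Lemma tangent_euclidean (p : E) (v : TM) : tangent p v.
Proof.
split=> [c []//|[] [] _ _].
have did : 'd (id : 'rV[R]_m -> 'rV[R]_m) p = id :> ('rV[R]_m -> 'rV[R]_m).
  exact: (diff_val (df := id)).
exact: (esym (congr1 (fun f => f (v tt)) did)).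
Qed.

Lemma coord_image_euclidean (U : set E) c : coord c @` (U `&` dom c) = U.
Proof. by rewrite setIT image_id. Qed.

Lemma vector_field_euclidean U X :
  vector_field U X <-> smooth_on (U : set 'rV[R]_m) (fun x => X x tt).
Proof.
split=> [[_ /(_ tt)]|H]; first by rewrite coord_image_euclidean.
split=> [p _|[]]; first exact: tangent_euclidean.
by rewrite coord_image_euclidean.
Qed.

Lemma smooth_function_euclidean U (f : E -> R) :
  smooth_function U f <-> smooth_on (U : set 'rV[R]_m) f.
Proof.
split=> [/(_ tt)|H []]; first by rewrite coord_image_euclidean.
by rewrite coord_image_euclidean.
Qed.

Lemma lie_bracket_euclidean X Y p :
  lie_bracket X Y p tt = 'D_(X p tt) (fun x => Y x tt) p
                         - 'D_(Y p tt) (fun x => X x tt) p.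
Proof. by rewrite /lie_bracket asboolT. Qed.

End EuclideanFields.

(** * The Levi-Civita connection of a metric on coordinate space *)
Lemma scalar_comb (R : realType) (V : lmodType R) m (e : 'I_m -> V)
    (l : V -> R) (v : 'rV[R]_m) : scalar l ->
  l (\sum_i v 0 i *: e i) = \sum_i v 0 i * l (e i).
Proof.
move=> hl.
have lD x y : l (x + y) = l x + l y by have := hl 1 x y; rewrite scale1r mul1r.
have l0 : l 0 = 0 by apply: (addrI (l 0)); rewrite -lD !addr0.
have lZ a x : l (a *: x) = a * l x by have := hl a x 0; rewrite l0 !addr0.
by rewrite (big_morph l lD l0); apply: eq_bigr => i _; exact: lZ.
Qed.

Lemma scalar_delta (R : realType) m (l : 'rV[R]_m -> R) w : scalar l ->
  l w = \sum_k w 0 k * l (delta_mx 0 k).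
Proof. by move=> hl; rewrite {1}(row_sum_delta w); exact: scalar_comb. Qed.
(* Derivatives, and the values of bilinear forms on them, become variables, so
   that they are never compared by unfolding the limits that define them. *)
Ltac bilin_ring :=
  repeat match goal with |- context [@bilin ?R ?m ?S ?u ?v] =>
    generalize (@bilin R m S u v); intro end; ring.

Ltac gen_derive :=
  repeat match goal with |- context [@derive ?K ?V ?W ?f ?x ?v] =>
    generalize (@derive K V W f x v); intro end.

Section LeviCivita.
Context {R : realType} {m : nat}.
Local Notation E := (euclidean (R := R) m).
Local Notation TM := (chart E -> 'rV[R]_m).
Variable G : 'rV[R]_m -> 'M[R]_m.
Hypothesis Gsmooth : smooth_on setT G.
Hypothesis Gsym : forall x, (G x)^T = G x.
Hypothesis Gunit : forall x, G x \in unitmx.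
Implicit Types (X Y Z : E -> TM) (U : set E).
Implicit Types (p x u v w : 'rV[R]_m).

Lemma metric_diff p : differentiable G p.
Proof. exact: smooth_differentiable Gsmooth I. Qed.

Lemma Dmetric_linear p : linear (fun u => 'D_u G p).
Proof. exact/derive_lin/metric_diff. Qed.

Lemma Dmetric_sym p u : ('D_u G p)^T = 'D_u G p.
Proof. exact: derive_trmx (metric_diff p) Gsym. Qed.

(** The Christoffel symbol of the first kind, given by the Koszul formula for
    constant fields. *)
Definition lower_christoffel p u v w :=
  2^-1 * (bilin ('D_u G p) v w + bilin ('D_v G p) u w - bilin ('D_w G p) u v).

Definition christoffel p u v : 'rV[R]_m :=
  (\row_k lower_christoffel p u v (delta_mx 0 k)) *m invmx (G p).

Lemma bilin_christoffel p u v w :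
  bilin (G p) (christoffel p u v) w = lower_christoffel p u v w.
Proof.
rewrite (@scalar_delta _ _ (lower_christoffel p u v)); last first.
  move=> a w1 w2; rewrite /lower_christoffel Dmetric_linear.
  gen_derive; rewrite !bilinDr !bilinZr bilinD bilinZ; bilin_ring.
rewrite /bilin /christoffel mulmxKV// mxE; apply: eq_bigr => k _.
by rewrite !mxE mulrC.
Qed.

(** The Koszul formula characterizes the Christoffel symbols, since the metric
    is nondegenerate; their algebraic properties are read off from it. *)
Lemma christoffel_eq p u v y :
  (forall w, bilin (G p) y w = lower_christoffel p u v w) ->
  y = christoffel p u v.
Proof.
move=> H; suff : y *m G p = christoffel p u v *m G p.
  by move/(congr1 (fun A => A *m invmx (G p))); rewrite !mulmxK.
apply/rowP => k; rewrite -!bilin_delta_r H bilin_christoffel//.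
Qed.

Lemma christoffelC p u v : christoffel p u v = christoffel p v u.
Proof.
apply: christoffel_eq => w; rewrite bilin_christoffel /lower_christoffel.
by rewrite -['D_w _ _ in LHS]Dmetric_sym bilinT; bilin_ring.
Qed.

Lemma christoffelPl p a u u' v :
  christoffel p (a *: u + u') v = a *: christoffel p u v + christoffel p u' v.
Proof.
symmetry; apply: christoffel_eq => w.
rewrite bilinDl bilinZl !bilin_christoffel /lower_christoffel Dmetric_linear.
gen_derive; rewrite bilinD bilinZ !bilinDl !bilinZl; bilin_ring.
Qed.

Lemma christoffel0l p v : christoffel p 0 v = 0.
Proof.
have := christoffelPl p 1 0 0 v; rewrite !scale1r addr0.
by rewrite -{1}[christoffel p 0 v]addr0 => /addrI.
Qed.
Lemma christoffel_smooth k U X Y : open U ->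
  class_C k (U : set 'rV[R]_m) (fun x => X x tt) ->
  class_C k (U : set 'rV[R]_m) (fun x => Y x tt) ->
  class_C k (U : set 'rV[R]_m) (fun x => christoffel x (X x tt) (Y x tt)).
Proof.
move=> oU cX cY.
have cG l : class_C l (U : set 'rV[R]_m) G by apply: class_CS (Gsmooth l).
apply: class_C_mulmx => //; last by apply: class_C_invmx.
apply/class_C_mxP => // i j; under eq_fun do rewrite mxE.
apply: class_CM => //; first exact: class_C_cst.
have cc (w : 'rV[R]_m) : class_C k (U : set 'rV[R]_m) (fun=> w).
  exact: class_C_cst.
have cD (Z : 'rV[R]_m -> 'rV[R]_m) : class_C k (U : set 'rV[R]_m) Z ->
    class_C k (U : set 'rV[R]_m) (fun x => 'D_(Z x) G x).
  by move=> cZ; exact: class_C_derive_mx.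
apply: class_CD => //.
  by apply: class_CD => //; apply: class_C_bilin => //; apply: cD.
under eq_fun do rewrite -mulN1r.
apply: class_CM => //; first exact: class_C_cst.
by apply: class_C_bilin => //; apply: cD.
Qed.

Definition christoffel_conn X Y : E -> TM := fun p _ =>
  'D_(X p tt) (fun x => Y x tt) p + christoffel p (X p tt) (Y p tt).

Definition matrix_metric (p : E) (u v : TM) : R := bilin (G p) (u tt) (v tt).

Lemma TM_eq (u v : TM) : u tt = v tt -> u = v.
Proof. by move=> H; apply/funext => -[]. Qed.

Lemma matrix_metric_pseudo_riemannian : pseudo_riemannian_metric matrix_metric.
Proof.
split.
- by move=> p a u v w _ _ _; rewrite /matrix_metric bilinDl bilinZl.
- by move=> p u v _ _; rewrite /matrix_metric -[in LHS]Gsym bilinT.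
- move=> p u _ H; apply: TM_eq.
  suff : u tt *m G p = 0.
    by move/(congr1 (fun A => A *m invmx (G p))); rewrite mulmxK// mul0mx.
  apply/rowP => k; rewrite -bilin_delta_r mxE.
  exact: (H (fun=> delta_mx 0 k) (tangent_euclidean _ _)).
- move=> U X Y oU /vector_field_euclidean cX /vector_field_euclidean cY.
  apply/smooth_function_euclidean => k.
  by apply: class_C_bilin => //; apply: class_CS (Gsmooth k).
Qed.

Lemma field_diff U X p : vector_field U X -> U p ->
  differentiable (fun x : 'rV[R]_m => X x tt) p.
Proof. by move=> /vector_field_euclidean/smooth_differentiable H /H. Qed.

Lemma near_open U p : open U -> U p -> \forall x \near p, U x.
Proof. by move=> oU Up; exact: open_nbhs_nbhs. Qed.

Lemma christoffel_conn_affine : affine_connection christoffel_conn.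
Proof.
split.
- move=> U X Y oU /vector_field_euclidean cX /vector_field_euclidean cY.
  apply/vector_field_euclidean => k; apply: class_CD => //.
    by apply: class_C_derive_mx.
  exact: christoffel_smooth.
- move=> U X X' Y Y' oU hX hY XX YY p Up; apply: TM_eq.
  rewrite /christoffel_conn (XX _ Up) (YY _ Up); congr (_ + _).
  apply: near_eq_derive; apply: filterS (near_open oU Up) => q Uq.
  by rewrite YY.
- move=> U X X' Y oU hX hX' hY p Up; apply: TM_eq.
  have dY := field_diff hY Up.
  rewrite /christoffel_conn -[RHS]/(_ + _) /=.
  have -> : (X + X') p tt = 1 *: X p tt + X' p tt by rewrite scale1r.
  by rewrite christoffelPl (derive_lin dY) !scale1r addrACA.
- move=> U f X Y oU hf hX hY p Up; apply: TM_eq.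
  have dY := field_diff hY Up.
  rewrite /christoffel_conn -[RHS]/(_ *: (_ + _)).
  have -> : (f p *: X p) tt = f p *: X p tt + 0 by rewrite addr0.
  rewrite christoffelPl (derive_lin dY) scalerDr derive0 addr0.
  by rewrite christoffel0l addr0.
- move=> U X Y Y' oU hX hY hY' p Up; apply: TM_eq.
  have dY := field_diff hY Up; have dY' := field_diff hY' Up.
  rewrite /christoffel_conn -[RHS]/(_ + _) /=.
  have -> : (fun x => (Y + Y') x tt) =
    (fun x => Y x tt) + (fun x => Y' x tt) by [].
  rewrite deriveD; [|exact: diff_derivable|exact: diff_derivable].
  have -> : (Y + Y') p tt = 1 *: Y p tt + Y' p tt by rewrite scale1r.
  rewrite christoffelC christoffelPl scale1r addrACA.
  by rewrite ![christoffel p _ (X p tt)]christoffelC.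
- move=> U f X Y oU /smooth_function_euclidean hf hX hY p c Up _; apply: TM_eq.
  have dY := field_diff hY Up.
  have df : differentiable (f : 'rV[R]_m -> R) p.
    exact: smooth_differentiable hf Up.
  rewrite /christoffel_conn -[RHS]/(_ *: _ + _ *: (_ + _)) /field_deriv.
  case: c.
  rewrite (derive_scalemx _ df dY).
  have -> : (f p *: Y p) tt = f p *: Y p tt + 0 by rewrite addr0.
  rewrite christoffelC christoffelPl scalerDr.
  by rewrite christoffel0l addr0 [christoffel p _ (X p tt)]christoffelC addrA.
Qed.

(** The torsion vanishes because [christoffel] is symmetric. The metric is
    parallel because in g(Gamma(x, y), z) + g(y, Gamma(x, z)) the terms of the
    Koszul formula cancel except for the derivative of the metric along x. *)
Lemma christoffel_conn_levi_civita :
  levi_civita_connection matrix_metric christoffel_conn.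
Proof.
split; first exact: christoffel_conn_affine.
- move=> U X Y oU hX hY p Up; apply: TM_eq.
  rewrite lie_bracket_euclidean.
  have -> : (christoffel_conn X Y p - christoffel_conn Y X p) tt =
    christoffel_conn X Y p tt - christoffel_conn Y X p tt by [].
  rewrite /christoffel_conn [christoffel p (Y p tt) _]christoffelC.
  by rewrite opprD addrACA subrr addr0.
- move=> U X Y Z oU hX hY hZ p c Up _.
  have dY := field_diff hY Up; have dZ := field_diff hZ Up.
  rewrite /field_deriv; case: c.
  have -> : 'D_(X p tt) ((fun q => matrix_metric q (Y q) (Z q)) \o
      chart_inv (tt : chart E)) (coord (tt : chart E) p)
    = 'D_(X p tt) (fun q => bilin (G q) (Y q tt) (Z q tt)) p by [].
  rewrite (derive_bilin _ (metric_diff p) dY dZ).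
  rewrite /matrix_metric /christoffel_conn.
  rewrite bilinDl bilinDr bilin_christoffel.
  rewrite -[X in _ = _ + (_ + X)]bilinT Gsym bilin_christoffel.
  rewrite /lower_christoffel.
  have := bilinT ('D_(X p tt) G p) (Y p tt) (Z p tt); rewrite Dmetric_sym.
  by gen_derive => ->; field.
Qed.

End LeviCivita.

(** * Curvature at a critical point of the metric *)
Lemma curvature_terms_cancel (V : zmodType) (a s c a' c' : V) :
  a + s + c - (a' + s + c') - (a - a') = c - c'.
Proof.
rewrite [- (_ + c')]opprD addrACA [- (a' + s)]opprD [a + s + _]addrACA subrr.
by rewrite addr0 [LHS]addrAC subrr add0r.
Qed.

Section Curvature.
Context {R : realType} {m : nat}.
Local Notation E := (euclidean (R := R) m).
Local Notation TM := (chart E -> 'rV[R]_m).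
Variable G : 'rV[R]_m -> 'M[R]_m.
Hypothesis Gsmooth : smooth_on setT G.
Hypothesis Gunit : forall x, G x \in unitmx.
Variable P : 'rV[R]_m.
Hypothesis DG0 : forall u, 'D_u G P = 0.
Variable U : set E.
Hypothesis oU : open U.
Hypothesis UP : U P.
Implicit Types (X Y Z : E -> TM) (u v w : 'rV[R]_m).

(* The Hessian of the metric. *)
Let D2 u v := 'D_u (fun q => 'D_v G q) P.

Lemma christoffel_critical u v : christoffel G P u v = 0.
Proof.
symmetry; apply: christoffel_eq => // w.
by rewrite /lower_christoffel !DG0 !bilin0 bilin0l addr0 subr0 mulr0.
Qed.

Lemma derive_DG_field (Y : 'rV[R]_m -> 'rV[R]_m) u : differentiable Y P ->
  'D_u (fun q => 'D_(Y q) G q) P = D2 u (Y P).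
Proof.
move=> dY; rewrite (derive_along_field u openT I (Gsmooth 2) dY).
by rewrite DG0 add0r.
Qed.

Lemma field_class_C X k : vector_field U X ->
  class_C k (U : set 'rV[R]_m) (fun x => X x tt).
Proof. by move=> /vector_field_euclidean. Qed.

Lemma class1_diff (F : normedModType R) (f : 'rV[R]_m -> F) :
  class_C 1 (U : set 'rV[R]_m) f -> differentiable f P.
Proof. by move=> [h _]; exact: h. Qed.

Lemma diff_DG_field (Y : 'rV[R]_m -> 'rV[R]_m) :
  class_C 1 (U : set 'rV[R]_m) Y ->
  differentiable (fun q => 'D_(Y q) G q) P.
Proof.
move=> cY; apply: class1_diff; apply: class_C_derive_mx => //.
exact: class_CS (Gsmooth 2).
Qed.

(** At the critical point only the Hessian of the metric survives, since every
    other term of the product rule has a first derivative of G as a factor. *)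
Lemma derive_bilin_DG (A B C : 'rV[R]_m -> 'rV[R]_m) u :
  class_C 1 (U : set 'rV[R]_m) A -> differentiable B P -> differentiable C P ->
  is_derive P u (fun q => bilin ('D_(A q) G q) (B q) (C q))
    (bilin (D2 u (A P)) (B P) (C P)).
Proof.
move=> cA dB dC.
have dD := diff_DG_field cA.
have e := derive_bilin u dD dB dC.
rewrite (derive_DG_field u (class1_diff cA)) in e.
rewrite DG0 !bilin0 !addr0 in e.
rewrite -e; apply: differentiable_is_derive.
exact: differentiable_bilin.
Qed.

(** The Koszul formula holds at every point, so it can be differentiated along
    [u]; the derivative of G on the left-hand side vanishes at P. *)
Lemma bilin_derive_christoffel Y Z u w :
  vector_field U Y -> vector_field U Z ->
  bilin (G P)
    ('D_u (fun q : 'rV[R]_m => christoffel G q (Y q tt) (Z q tt)) P) w =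
  2^-1 * (bilin (D2 u (Y P tt)) (Z P tt) w + bilin (D2 u (Z P tt)) (Y P tt) w
          - bilin (D2 u w) (Y P tt) (Z P tt)).
Proof.
move=> hY hZ.
have dY := class1_diff (field_class_C 1 hY).
have dZ := class1_diff (field_class_C 1 hZ).
have dC : differentiable
    (fun q : 'rV[R]_m => christoffel G q (Y q tt) (Z q tt)) P.
  apply: class1_diff; apply: (christoffel_smooth Gsmooth Gunit oU);
    exact: field_class_C.
have dw : differentiable (fun _ : 'rV[R]_m => w) P by exact: differentiable_cst.
have := derive_bilin u (metric_diff Gsmooth P) dC dw.
rewrite DG0 bilin0 add0r derive_cst bilin0r addr0 => <-.
have -> : (fun q : 'rV[R]_m =>
    bilin (G q) (christoffel G q (Y q tt) (Z q tt)) w) =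
  (fun q => 2^-1 * (bilin ('D_(Y q tt) G q) (Z q tt) w
     + bilin ('D_(Z q tt) G q) (Y q tt) w
     - bilin ('D_w G q) (Y q tt) (Z q tt))).
  by apply/funext => q; rewrite bilin_christoffel.
have H1 := derive_bilin_DG u (field_class_C 1 hY) dZ dw.
have H2 := derive_bilin_DG u (field_class_C 1 hZ) dY dw.
have H3 := derive_bilin_DG u (class_C_cst 1 _ w) dY dZ.
have H := is_deriveZ 2^-1 (is_deriveB (is_deriveD H1 H2) H3).
exact: (derive_val (is_derive := H)).
Qed.

Lemma derive_christoffel_conn X Y Z : vector_field U Y -> vector_field U Z ->
  let x := X P tt in
  christoffel_conn G X (christoffel_conn G Y Z) P tt =
  'D_('D_x (fun q => Y q tt) P) (fun q => Z q tt) P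
  + 'D_x (fun q => 'D_(Y P tt) (fun q => Z q tt) q) P
  + 'D_x (fun q : 'rV[R]_m => christoffel G q (Y q tt) (Z q tt)) P.
Proof.
move=> hY hZ x; rewrite /christoffel_conn christoffel_critical addr0.
have dY := class1_diff (field_class_C 1 hY).
have dD : differentiable
    (fun q : 'rV[R]_m => 'D_(Y q tt) (fun x => Z x tt) q) P.
  apply: class1_diff; apply: class_C_derive_mx => //; exact: field_class_C.
have dC : differentiable
    (fun q : 'rV[R]_m => christoffel G q (Y q tt) (Z q tt)) P.
  apply: class1_diff; apply: (christoffel_smooth Gsmooth Gunit oU);
    exact: field_class_C.
have -> : (fun q : E =>
    'D_(Y q tt) (fun x => Z x tt) q + christoffel G q (Y q tt) (Z q tt)) =
  (fun q : 'rV[R]_m => 'D_(Y q tt) (fun x => Z x tt) q)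
  + (fun q => christoffel G q (Y q tt) (Z q tt)) by [].
rewrite (deriveD (diff_derivable dD) (diff_derivable dC)); congr (_ + _).
exact: (derive_along_field _ oU UP (field_class_C 2 hZ) dY).
Qed.

(** The derivatives of the fields contribute nothing: the second derivatives of
    Z cancel by symmetry, and the remaining first derivatives of Z form the
    derivative of Z along [X, Y], which the third term of the curvature
    operator subtracts. What is left is the difference of two derivatives of the
    Christoffel symbols. *)
Lemma curvature_at_critical_point X Y Z (W : TM) :
  vector_field U X -> vector_field U Y -> vector_field U Z ->
  let x := X P tt in let y := Y P tt in let z := Z P tt in let w := W tt in
  matrix_metric G P (curvature_operator (christoffel_conn G) X Y Z P) W =
  2^-1 * (bilin (D2 x z) y w + bilin (D2 y w) x z
          - bilin (D2 x w) y z - bilin (D2 y z) x w).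
Proof.
move=> hX hY hZ x y z w.
have dZ := class1_diff (field_class_C 1 hZ).
rewrite /matrix_metric.
have -> : curvature_operator (christoffel_conn G) X Y Z P tt =
  'D_x (fun q : 'rV[R]_m => christoffel G q (Y q tt) (Z q tt)) P
  - 'D_y (fun q : 'rV[R]_m => christoffel G q (X q tt) (Z q tt)) P.
  have -> : curvature_operator (christoffel_conn G) X Y Z P tt =
     christoffel_conn G X (christoffel_conn G Y Z) P tt
     - christoffel_conn G Y (christoffel_conn G X Z) P tt
     - christoffel_conn G (lie_bracket X Y) Z P tt by [].
  rewrite !derive_christoffel_conn//.
  rewrite /christoffel_conn christoffel_critical addr0 lie_bracket_euclidean.
  rewrite -(derive_sym_mx y x oU UP (field_class_C 2 hZ)).
  rewrite (derive_dirB _ _ dZ).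
  exact: curvature_terms_cancel.
have E1 := bilin_derive_christoffel x w hY hZ.
have E2 := bilin_derive_christoffel y w hX hZ.
have E3 : D2 y x = D2 x y by exact: (derive_sym_mx x y openT I (Gsmooth 2)).
rewrite -/x -/y -/z E3 in E1 E2.
move: E1 E2; rewrite -/w.
set c1 := 'D_x _ P; set c2 := 'D_y _ P; move: c1 c2 => c1 c2 E1 E2.
rewrite bilinDl bilinNl E1 E2.
generalize (D2 x y) (D2 x z) (D2 x w) (D2 y z) (D2 y w) => *; bilin_ring.
Qed.

End Curvature.

(** * A Hessian with prescribed curvature *)
Section HessianForm.
Context {R : realType} {V : vectType R}.
Variables (A : V -> V -> V -> V -> R) (J : V -> V).
Hypothesis hA : algebraic_curvature_tensor A.
Hypothesis Jlin : linear J.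
Hypothesis JJ : forall x, J (J x) = x.
Hypothesis hG : eigen_vanishing A J.

Let AD := (actD1 hA, actD2 hA, actD3 hA, actD4 hA).
Let AZ := (actZ1 hA, actZ2 hA, actZ3 hA, actZ4 hA).
Let A0 := (act01 hA, act02 hA, act03 hA, act04 hA).

(** For e = 1 and e = - 1, the projections to the eigenspaces of J. *)
Definition eproj (e : R) x := 2^-1 *: (x + e *: J x).
Local Notation pp := (eproj 1).
Local Notation nn := (eproj (-1)).

Lemma eprojP e a x y : eproj e (a *: x + y) = a *: eproj e x + eproj e y.
Proof.
rewrite /eproj Jlin scalerA [a * _]mulrC -scalerA -scalerDr; congr (_ *: _).
by rewrite !scalerDr !scalerA [a * e]mulrC addrACA.
Qed.

Lemma eproj_split x : pp x + nn x = x.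
Proof.
by rewrite /eproj -scalerDr scale1r scaleN1r addrACA subrr addr0 half_double.
Qed.

Lemma eprojJ e x : e * e = 1 -> eproj e (J x) = e *: eproj e x.
Proof.
move=> e2; rewrite /eproj JJ scalerA [e * _]mulrC -scalerA; congr (_ *: _).
by rewrite scalerDr scalerA e2 scale1r addrC.
Qed.

Lemma eproj_eigen e x : J x = e *: x -> e * e = 1 -> eproj e x = x.
Proof. by move=> h e2; rewrite /eproj h scalerA e2 scale1r half_double. Qed.

Lemma eproj_eigenN e x : J x = e *: x -> e * e = 1 -> eproj (- e) x = 0.
Proof.
by move=> h e2; rewrite /eproj h scalerA mulNr e2 scaleN1r subrr scaler0.
Qed.

(** The Hessian H(u, v; a, q) for [a] in the eigenspace of 1 and [q] in that of
    - 1, where [u1], [u2] and [v1], [v2] are the components of u and v in these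
    eigenspaces. The three types of (u, v) are solved separately. If u and v are
    both in the eigenspace of 1, the equation for three arguments of one kind is
        A(a, b, c, q) = H(a, c; b, q) - H(b, c; a, q),
    and H(a, c; b, q) = (A(a, b, c, q) + A(c, b, a, q)) / 3 solves it by the
    Bianchi identity. The case of - 1 is its mirror image.
    If u and v are of different kinds, the equation is
        A(a, p, b, q) = - H(a, q; b, p) - H(b, p; a, q),
    and H(a, q; b, p) = - A(a, p, b, q) / 2 solves it by the pair symmetry. *)
Definition hform u1 u2 v1 v2 a q : R :=
  3^-1 * (A u1 a v1 q + A v1 a u1 q) + 3^-1 * (A u2 q v2 a + A v2 q u2 a)
  - 2^-1 * (A u1 q a v2 + A v1 q a u2).

Ltac A_ring := repeat match goal with |- context [A ?x ?y ?z ?w] =>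
  generalize (A x y z w); intro end; ring.

Lemma hformP12 k u1 u1' u2 u2' v1 v2 a q :
  hform (k *: u1 + u1') (k *: u2 + u2') v1 v2 a q =
  k * hform u1 u2 v1 v2 a q + hform u1' u2' v1 v2 a q.
Proof. by rewrite /hform !(AD, AZ); A_ring. Qed.

Lemma hformC u1 u2 v1 v2 a q : hform v1 v2 u1 u2 a q = hform u1 u2 v1 v2 a q.
Proof. by rewrite /hform; A_ring. Qed.

Lemma hformP5 u1 u2 v1 v2 k a a' q :
  hform u1 u2 v1 v2 (k *: a + a') q =
  k * hform u1 u2 v1 v2 a q + hform u1 u2 v1 v2 a' q.
Proof. by rewrite /hform !(AD, AZ); A_ring. Qed.

Lemma hformP6 u1 u2 v1 v2 k a q q' :
  hform u1 u2 v1 v2 a (k *: q + q') =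
  k * hform u1 u2 v1 v2 a q + hform u1 u2 v1 v2 a q'.
Proof. by rewrite /hform !(AD, AZ); A_ring. Qed.

Lemma hformN6 u1 u2 v1 v2 a q :
  hform u1 u2 v1 v2 a (- q) = - hform u1 u2 v1 v2 a q.
Proof. by rewrite -scaleN1r /hform !AZ; A_ring. Qed.

(** Zero on two vectors [x], [y] of one eigenspace, as compatibility with J
    demands. *)
Definition hess u v x y :=
  hform (pp u) (nn u) (pp v) (nn v) (pp x) (nn y)
  + hform (pp u) (nn u) (pp v) (nn v) (pp y) (nn x).

Lemma hessC12 u v x y : hess v u x y = hess u v x y.
Proof. by rewrite /hess !(hformC (pp u)). Qed.

Lemma hessC34 u v x y : hess u v y x = hess u v x y.
Proof. by rewrite /hess addrC. Qed.

Lemma hess_scalar1 v x y : scalar (fun u => hess u v x y).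
Proof.
move=> a u u'; rewrite /hess !eprojP !hformP12.
by rewrite addrACA -mulrDr.
Qed.

Lemma hess_scalar3 u v y : scalar (fun x => hess u v x y).
Proof.
move=> a x x'; rewrite /hess !eprojP hformP5 hformP6.
by rewrite addrACA -mulrDr.
Qed.

Lemma hessJ u v x y : hess u v (J x) (J y) = - hess u v x y.
Proof.
rewrite /hess !eprojJ ?mulr1 ?mulrNN ?mulr1//.
by rewrite !scale1r !scaleN1r !hformN6 -opprD.
Qed.

(** The curvature at the origin of a metric with Hessian 2 [hess]. *)
Definition hess_curv x y z w :=
  hess x z y w + hess y w x z - hess x w y z - hess y z x w.

(** On arguments from one eigenspace both sides vanish. Otherwise the symmetries
    express all 24 values of A on permutations of the arguments by the two
    values [s] and [t] below, and each of the sign patterns is a linear identity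
    between them. *)
Lemma hess_curv_eigen (s1 s2 s3 s4 : bool) x y z w :
  J x = (-1) ^+ s1 *: x -> J y = (-1) ^+ s2 *: y -> J z = (-1) ^+ s3 *: z ->
  J w = (-1) ^+ s4 *: w -> hess_curv x y z w = A x y z w.
Proof.
have e1 : 1 * 1 = 1 :> R by rewrite mulr1.
have e2 : -1 * -1 = 1 :> R by rewrite mulrNN mulr1.
have P (s : bool) u : J u = (-1) ^+ s *: u ->
    pp u = (if s then 0 else u) /\ nn u = (if s then u else 0).
  case: s => /= h; split.
  - by rewrite -(opprK 1); apply: eproj_eigenN.
  - exact: eproj_eigen.
  - exact: eproj_eigen.
  - by rewrite eproj_eigenN.
move=> hx hy hz hw.
have := @hG ((-1) ^+ s1) x y z w; rewrite -expr2 sqrr_sign => /(_ erefl hx).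
move: hy hz hw => /[dup]/P[py ny] hy /[dup]/P[pz nz] hz /[dup]/P[pw nw] hw H.
have [px nx] := P _ _ hx.
rewrite /hess_curv /hess /hform px nx py ny pz nz pw nw.
have b1 := act_bianchi hA x y z w.
have S a b c d : A a b c d = - A b a c d by exact: act_skew hA a b c d.
have S' a b c d : A a b c d = - A a b d c.
  by rewrite (act_pair hA) S (act_pair hA).
have Q a b c d : A a b c d = A c d a b by exact: act_pair hA a b c d.
pose s := A x y z w; pose t := A x z y w.
have f1 : A y x z w = - s by rewrite S.
have f2 : A x y w z = - s by rewrite S'.
have f3 : A y x w z = s by rewrite S S' opprK.
have f4 : A z w x y = s by rewrite Q.
have f5 : A w z x y = - s by rewrite Q f2.
have f6 : A z w y x = - s by rewrite Q f1.
have f7 : A w z y x = s by rewrite Q f3.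
have g1 : A z x y w = - t by rewrite S.
have g2 : A x z w y = - t by rewrite S'.
have g3 : A z x w y = t by rewrite S S' opprK.
have g4 : A y w x z = t by rewrite Q.
have g5 : A w y x z = - t by rewrite Q g2.
have g6 : A y w z x = - t by rewrite Q g1.
have g7 : A w y z x = t by rewrite Q g3.
have h0 : A y z x w = t - s by rewrite -[A x y z w]/s g1 in b1; lra.
have h1 : A z y x w = - (t - s) by rewrite S h0.
have h2 : A y z w x = - (t - s) by rewrite S' h0.
have h3 : A z y w x = (t - s) by rewrite S S' opprK.
have h4 : A x w y z = t - s by rewrite Q.
have h5 : A w x y z = - (t - s) by rewrite Q h2.
have h6 : A x w z y = - (t - s) by rewrite Q h1.
have h7 : A w x z y = t - s by rewrite Q h3.
have F := (f1, f2, f3, f4, f5, f6, f7,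
  
  g1, g2, g3, g4, g5, g6, g7, h0, h1, h2, h3, h4, h5, h6, h7).
rewrite -/s; case: s1 s2 s3 s4 hx hy hz hw H {px nx py ny pz nz pw nw}
  => [] [] [] [] hx hy hz hw H /=; rewrite ?A0 ?F -/s -/t; try lra.
all: by have := H hy hz hw; rewrite -/s; lra.
Qed.

Lemma hess_curvE x y z w : hess_curv x y z w = A x y z w.
Proof.
have hD1 u u' v x' y' :
    hess (u + u') v x' y' = hess u v x' y' + hess u' v x' y'.
  by have := hess_scalar1 v x' y' 1 u u'; rewrite scale1r mul1r.
have hD2 u v v' x' y' :
    hess u (v + v') x' y' = hess u v x' y' + hess u v' x' y'.
  by rewrite hessC12 hD1 !(hessC12 u).
have hD3 u v x' x'' y' :
    hess u v (x' + x'') y' = hess u v x' y' + hess u v x'' y'.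
  by have := hess_scalar3 u v y' 1 x' x''; rewrite scale1r mul1r.
have hD4 u v x' y' y'' :
    hess u v x' (y' + y'') = hess u v x' y' + hess u v x' y''.
  by rewrite hessC34 hD3 !(hessC34 _ _ x').
have E (s : bool) u :
    J (eproj ((-1) ^+ s) u) = (-1) ^+ s *: eproj ((-1) ^+ s) u.
  rewrite /eproj (lin_scale Jlin) (lin_add Jlin) (lin_scale Jlin) JJ.
  rewrite scalerA [_ ^+ _ * _]mulrC -scalerA; congr (_ *: _).
  by rewrite scalerDr scalerA -expr2 sqrr_sign scale1r addrC.
have T s1 s2 s3 s4 := hess_curv_eigen (E s1 x) (E s2 y) (E s3 z) (E s4 w).
have D1 a a' b c d :
    hess_curv (a + a') b c d = hess_curv a b c d + hess_curv a' b c d.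
  by rewrite /hess_curv !(hD1, hD2, hD3, hD4); ring.
have D2 a b b' c d :
    hess_curv a (b + b') c d = hess_curv a b c d + hess_curv a b' c d.
  by rewrite /hess_curv !(hD1, hD2, hD3, hD4); ring.
have D3 a b c c' d :
    hess_curv a b (c + c') d = hess_curv a b c d + hess_curv a b c' d.
  by rewrite /hess_curv !(hD1, hD2, hD3, hD4); ring.
have D4 a b c d d' :
    hess_curv a b c (d + d') = hess_curv a b c d + hess_curv a b c d'.
  by rewrite /hess_curv !(hD1, hD2, hD3, hD4); ring.
rewrite -(eproj_split x) -(eproj_split y) -(eproj_split z) -(eproj_split w).
rewrite !(D1, D2, D3, D4) !AD.
have T0 := (T false false false false, T true false false false,
  T false true false false, T true true false false,
  T false false true false, T true false true false,
  T false true true false, T true true true false,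
  T false false false true, T true false false true,
  T false true false true, T true true false true,
  T false false true true, T true false true true,
  T false true true true, T true true true true).
by rewrite /= expr0 expr1 in T0; rewrite !T0.
Qed.

End HessianForm.

(** * The realizing metric *)
Lemma signature_basis (R : realType) (V : vectType R) (b : V -> V -> R) n :
  has_signature b n n ->
  exists (e : (n.*2).-tuple V) (s : 'I_(n.*2) -> R),
    [/\ basis_of fullv e, forall i, s i * s i = 1 &
      forall i j, b (tnth e i) (tnth e j) = s i *+ (i == j)].
Proof.
rewrite /has_signature -addnn => -[e [be he]].
exists e, (fun i => (-1) ^+ (n <= i)%N); split => // i.
by rewrite -expr2 sqrr_sign.
Qed.

Lemma derive_conformal (R : realType) (E : normedModType R) (r h : E -> R) C k
    dr dh x v :
  is_derive x v r dr -> is_derive x v h dh ->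
  is_derive x v (fun y => (1 + C * r y * (C * r y)) * k + h y)
    (2 * C ^+ 2 * k * (r x * dr) + dh).
Proof.
move=> Hr Hh.
have -> : (fun y => (1 + C * r y * (C * r y)) * k + h y) =
    cst k + (C ^+ 2 * k) \*: (r * r) + h.
  apply/funext => y /=.
  have -> : (cst k + (C ^+ 2 * k) \*: (r * r) + h) y =
    k + (C ^+ 2 * k) * (r y * r y) + h y by [].
  ring.
have Hk : is_derive x v (cst k) 0 by exact: is_derive_cst.
have Hrr := is_deriveZ (C ^+ 2 * k) (is_deriveM Hr Hr).
have H := is_deriveD (is_deriveD Hk Hrr) Hh.
apply: is_derive_eq; rewrite /GRing.scale /=; ring.
Qed.

Lemma nijenhuis_terms_cancel (W : zmodType) (x y z t : W) :
  x - y - (z - y) - (x - t) + (z - t) = 0.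
Proof. by rewrite !opprB subrKA [_ + (t - x)]addrC subrKA subrKA subrr. Qed.
Section Realize.
Context {R : realType} {V : vectType R} {n : nat}.
Variables (b : V -> V -> R) (J : V -> V) (A : V -> V -> V -> V -> R).
Hypothesis hP : para_hermitian_structure n b J.
Hypothesis hA : algebraic_curvature_tensor A.
Hypothesis hG : eigen_vanishing A J.
Local Notation m := (n.*2).
Variables (e : m.-tuple V) (s : 'I_m -> R).
Hypothesis be : basis_of fullv e.
Hypothesis s2 : forall i, s i * s i = 1.
Hypothesis he : forall i j, b (tnth e i) (tnth e j) = s i *+ (i == j).

Let Jlin := phs_linear hP.
Let JJ := phs_involutive hP.
Local Notation hess := (hess A J).
Local Notation E := (euclidean (R := R) m).
Local Notation TM := (chart E -> 'rV[R]_m).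

Let ev i := tnth e i.

Definition coords (x : V) : 'rV[R]_m := \row_i vector.coord e i x.
Definition lincomb (v : 'rV[R]_m) : V := \sum_i v 0 i *: tnth e i.

Lemma coordsK x : lincomb (coords x) = x.
Proof.
rewrite /lincomb [RHS](coord_basis be (memvf x)); apply: eq_bigr => i _.
by rewrite mxE (tnth_nth 0).
Qed.

Lemma lincombK v : coords (lincomb v) = v.
Proof.
apply/rowP => i; rewrite mxE /lincomb.
under eq_bigr do rewrite (tnth_nth 0).
by rewrite coord_sum_free// (basis_free be).
Qed.

Lemma coordsP a x y : coords (a *: x + y) = a *: coords x + coords y.
Proof. by apply/rowP => i; rewrite !mxE linearP. Qed.

Lemma lincomb0 : lincomb 0 = 0.
Proof. by rewrite /lincomb big1// => i _; rewrite mxE scale0r. Qed.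

Definition form_mx (beta : V -> V -> R) : 'M[R]_m :=
  \matrix_(i, j) beta (ev i) (ev j).

Lemma bilin_form_mx (beta : V -> V -> R) u v :
  (forall y, scalar (fun x => beta x y)) -> (forall x, scalar (beta x)) ->
  bilin (form_mx beta) u v = beta (lincomb u) (lincomb v).
Proof.
move=> h1 h2; rewrite bilinE; symmetry.
apply: etrans (scalar_comb (tnth e) u (h1 (lincomb v))) _.
apply: eq_bigr => i _; rewrite /lincomb (scalar_comb _ _ (h2 _)) mulr_sumr.
by apply: eq_bigr => j _; rewrite mxE mulrA mulrC.
Qed.

Let bil := phs_bilinear hP.

Lemma hess_scalar2 u x y : scalar (fun v => hess u v x y).
Proof.
move=> a v v'; have := hess_scalar1 hA Jlin u x y a v v'.
by rewrite !(hessC12 A J _ u).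
Qed.

Lemma hess_scalar4 u v x : scalar (fun y => hess u v x y).
Proof.
move=> a y y'; have := hess_scalar3 hA Jlin u v x a y y'.
by rewrite !(hessC34 A J _ _ x).
Qed.

(** The pair [i], [j] selects an entry of the metric; the matrix is that of the
    quadratic form of this entry in the base point. *)
Definition hess_mx i j := form_mx (fun x y => hess x y (ev i) (ev j)).

Lemma bilin_hess_mx i j u v :
  bilin (hess_mx i j) u v = hess (lincomb u) (lincomb v) (ev i) (ev j).
Proof.
rewrite bilin_form_mx// => ?; first exact: hess_scalar1.
exact: hess_scalar2.
Qed.

Definition sqnorm (q : 'rV[R]_m) := bilin 1%:M q q.
(** The constant k in c(q) = (k |q|^2)^2: H(q, q; v, w) is bounded by
    k |q|^2 |v| |w|. *)
Definition hess_size : R :=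
  \sum_i \sum_j \sum_k \sum_l `|hess (ev k) (ev l) (ev i) (ev j)|.

(** The Gram matrix at [q] of the metric (1 + c(q)) b + H(q, q; ., .). *)
Definition realizing_mx (q : 'rV[R]_m) : 'M[R]_m := \matrix_(i, j)
  ((1 + (hess_size * sqnorm q) * (hess_size * sqnorm q)) * b (ev i) (ev j)
   + bilin (hess_mx i j) q q).

Lemma bilin_realizing_mx q u v : bilin (realizing_mx q) u v =
  (1 + (hess_size * sqnorm q) * (hess_size * sqnorm q)) *
    b (lincomb u) (lincomb v) +
  hess (lincomb q) (lincomb q) (lincomb u) (lincomb v).
Proof.
have -> : realizing_mx q =
   (1 + (hess_size * sqnorm q) * (hess_size * sqnorm q)) *: form_mx b
   + form_mx (hess (lincomb q) (lincomb q)).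
  by apply/matrixP => i j; rewrite !mxE bilin_hess_mx.
rewrite bilinD bilinZ !bilin_form_mx//; try exact: bil.1; try exact: bil.2.
  by move=> y; exact: hess_scalar3.
by move=> x; exact: hess_scalar4.
Qed.

Lemma realizing_mx_smooth : smooth_on setT realizing_mx.
Proof.
move=> k; have o : open [set: 'rV[R]_m] by exact: openT.
apply/class_C_mxP => // i j.
have cb S : class_C k setT (fun q : 'rV[R]_m => bilin S q q).
  by apply: class_C_bilin => //; [exact: class_C_cst|..]; exact: smooth_on_id.
have cc (a : R) : class_C k [set: 'rV[R]_m] (fun=> a) by exact: class_C_cst.
under eq_fun do rewrite mxE.
have ct : class_C k setT (fun q : 'rV[R]_m => hess_size * sqnorm q).
  by apply: class_CM; [|exact: cc|exact: cb].
apply: class_CD; [by []| |exact: cb].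
apply: class_CM; [by []| |exact: cc].
by apply: class_CD; [|exact: cc|exact: class_CM].
Qed.

Lemma realizing_mx_sym q : (realizing_mx q)^T = realizing_mx q.
Proof.
apply/matrixP => i j; rewrite !mxE (phs_sym hP) !bilin_hess_mx.
by rewrite hessC34.
Qed.

Lemma sqnormE v : sqnorm v = \sum_i v 0 i ^+ 2.
Proof.
rewrite /sqnorm bilinE; apply: eq_bigr => i _.
rewrite (bigD1 i)//= mxE eqxx mul1r big1 ?addr0 ?expr2// => j ji.
by rewrite mxE eq_sym (negbTE ji) mul0r.
Qed.

Lemma sqnorm_ge0 v : 0 <= sqnorm v.
Proof. by rewrite sqnormE; apply: sumr_ge0 => i _; exact: sqr_ge0. Qed.

Lemma coord_sqnorm (v : 'rV[R]_m) i : v 0 i ^+ 2 <= sqnorm v.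
Proof.
rewrite sqnormE (bigD1 i)//= lerDl; apply: sumr_ge0 => j _; exact: sqr_ge0.
Qed.

Lemma coord2_sqnorm (v : 'rV[R]_m) i j : `|v 0 i| * `|v 0 j| <= sqnorm v.
Proof.
have hi := coord_sqnorm v i; have hj := coord_sqnorm v j.
have : 0 <= (`|v 0 i| - `|v 0 j|) ^+ 2 by exact: sqr_ge0.
rewrite sqrrB !real_normK ?num_real//; lra.
Qed.

(** The form in which the bound is used: [w] is [v] up to signs of the
    coordinates. *)
Lemma hess_bound q (v w : 'rV[R]_m) : (forall j, `|w 0 j| = `|v 0 j|) ->
  `|hess (lincomb q) (lincomb q) (lincomb v) (lincomb w)| <=
  hess_size * sqnorm q * sqnorm v.
Proof.
move=> wv.
rewrite -(bilin_form_mx (beta := hess (lincomb q) (lincomb q))); first last.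
- by move=> x; exact: hess_scalar4.
- by move=> x; exact: hess_scalar3.
rewrite bilinE /hess_size !mulr_suml; apply: (le_trans (ler_norm_sum _ _ _)).
apply: ler_sum => i _; rewrite !mulr_suml.
apply: (le_trans (ler_norm_sum _ _ _)); apply: ler_sum => j _.
rewrite !mxE -/(ev i) -/(ev j) -bilin_hess_mx bilinE normrM.
apply: ler_pM => //; last by rewrite normrM wv; exact: coord2_sqnorm.
apply: (le_trans (ler_norm_sum _ _ _)); rewrite mulr_suml.
apply: ler_sum => k _; rewrite mulr_suml.
apply: (le_trans (ler_norm_sum _ _ _)); apply: ler_sum => l _.
rewrite normrM mxE; apply: ler_wpM2l => //.
by rewrite normrM; exact: coord2_sqnorm.
Qed.

(** Pair a vector v of the kernel with the vector w obtained by multiplying its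
    coordinates by the signs of the basis, so that b(v, w) = |v|^2. With
    t = k |q|^2 the value of the metric on v, w is at least
    (1 + t^2 - t) |v|^2. *)
Lemma realizing_mx_unit q : realizing_mx q \in unitmx.
Proof.
rewrite unitmxE unitfE; apply/negP => /det0P[v v0 vG].
pose w := \row_j (s j * v 0 j).
have B0 : bilin (realizing_mx q) v w = 0 by rewrite /bilin vG mul0mx mxE.
have ns j : `|s j| = 1.
  by apply/eqP; rewrite -[_ == _](@pexpr_eq1 _ _ 2)// -normrX expr2 s2 normr1.
have bw : b (lincomb v) (lincomb w) = sqnorm v.
  rewrite -(bilin_form_mx _ _ bil.1 bil.2) bilinE sqnormE.
  apply: eq_bigr => i _.
  rewrite (bigD1 i)//= big1 ?addr0 => [|j ji]; last first.
    by rewrite mxE he eq_sym (negbTE ji) mul0r.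
  by rewrite !mxE he eqxx mulr1n mulrCA [s i * (s i * _)]mulrA s2 mul1r expr2.
have hb : `|hess (lincomb q) (lincomb q) (lincomb v) (lincomb w)| <=
    hess_size * sqnorm q * sqnorm v.
  by apply: hess_bound => j; rewrite mxE normrM ns mul1r.
have sv : 0 < sqnorm v.
  rewrite lt_neqAle sqnorm_ge0 andbT eq_sym sqnormE psumr_eq0; last first.
    by move=> i _; exact: sqr_ge0.
  apply: contra v0 => /allP h; apply/eqP/rowP => i; rewrite mxE.
  by have := h i (mem_index_enum i); rewrite /= expf_eq0 /= => /eqP.
move: B0 hb; rewrite bilin_realizing_mx bw ler_norml.
set t := hess_size * sqnorm q; set h := hess _ _ _ _ => B0 /andP[hb _].
have t1 : 0 < 1 + t * t - t.
  have : 0 <= (t - 2^-1) ^+ 2 by exact: sqr_ge0.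
  by rewrite sqrrB; lra.
have : 0 < (1 + t * t - t) * sqnorm v by rewrite mulr_gt0.
by lra.
Qed.

Lemma derive_realizing_mx_entry i j u q :
  'D_u (fun x => realizing_mx x i j) q =
  2 * hess_size ^+ 2 * b (ev i) (ev j) *
    (sqnorm q * (bilin 1%:M u q + bilin 1%:M q u))
  + (bilin (hess_mx i j) u q + bilin (hess_mx i j) q u).
Proof.
under eq_fun do rewrite mxE.
have H1 := derive_quad 1%:M u q; have H2 := derive_quad (hess_mx i j) u q.
have H := derive_conformal hess_size (b (ev i) (ev j)) H1 H2.
exact: (derive_val (is_derive := H)).
Qed.

Lemma sqnorm0 : sqnorm 0 = 0.
Proof. exact: bilin0l. Qed.

Lemma realizing_mx_differentiable q : differentiable realizing_mx q.
Proof. exact: (metric_diff realizing_mx_smooth). Qed.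

(** Each entry of the metric is a constant plus terms of order 2 and 4 in the
    base point. *)
Lemma Drealizing_mx_origin u : 'D_u realizing_mx 0 = 0.
Proof.
apply/matrixP => i j.
rewrite -(derive_entry i j (diff_derivable (realizing_mx_differentiable 0))).
by rewrite derive_realizing_mx_entry !bilin0l !bilin0r !addr0 !mulr0 mxE.
Qed.

(** The factor 1 + c(q) does not contribute, because c vanishes to order 4. *)
Lemma D2realizing_mx_origin u v :
  'D_u (fun q => 'D_v realizing_mx q) 0 =
  2 *: form_mx (hess (lincomb u) (lincomb v)).
Proof.
apply/matrixP => i j.
have dD : differentiable (fun q => 'D_v realizing_mx q) 0.
  exact: ((realizing_mx_smooth 2).2 v).1.
rewrite -(derive_entry i j (diff_derivable dD)).
have -> : (fun q => ('D_v realizing_mx q) i j) = (fun q =>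
    2 * hess_size ^+ 2 * b (ev i) (ev j) *
      (sqnorm q * (bilin 1%:M v q + bilin 1%:M q v))
    + (bilin (hess_mx i j) v q + bilin (hess_mx i j) q v)).
  apply/funext => q; rewrite -derive_realizing_mx_entry derive_entry//.
  exact: (diff_derivable (realizing_mx_differentiable q)).
have H1 := derive_quad 1%:M u 0; have H2 := derive_polar 1%:M v u 0.
have H3 := derive_polar (hess_mx i j) v u 0.
set c := 2 * hess_size ^+ 2 * _.
have H := is_deriveD (is_deriveZ c (is_deriveM H1 H2)) H3.
rewrite [LHS](derive_val (is_derive := H)).
rewrite !bilin0l !bilin0r !(addr0, scale0r, scaler0, add0r).
rewrite !bilin_hess_mx !mxE -/(ev i) -/(ev j) (hessC12 A J (lincomb u)).
ring.
Qed.

Lemma bilin_D2realizing_mx u v x y :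
  bilin ('D_(coords u) (fun q => 'D_(coords v) realizing_mx q) 0)
    (coords x) (coords y) = 2 * hess u v x y.
Proof.
rewrite D2realizing_mx_origin bilinZ bilin_form_mx => [|?|?].
- by rewrite !coordsK.
- exact: hess_scalar3.
- exact: hess_scalar4.
Qed.

Definition J_mx : 'M[R]_m := \matrix_(i, j) coords (J (ev i)) 0 j.

Lemma mul_J_mx u : u *m J_mx = coords (J (lincomb u)).
Proof.
have lJ j : scalar (fun x => coords (J x) 0 j).
  by move=> a x y; rewrite Jlin coordsP !mxE.
apply/rowP => j; rewrite /lincomb (scalar_comb (tnth e) u (lJ j)) mxE.
by apply: eq_bigr => i _; rewrite mxE.
Qed.

Lemma lincomb_J_mx u : lincomb (u *m J_mx) = J (lincomb u).
Proof. by rewrite mul_J_mx coordsK. Qed.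

Lemma J_mxK (u : 'rV[R]_m) : u *m J_mx *m J_mx = u.
Proof. by rewrite [LHS]mul_J_mx lincomb_J_mx JJ lincombK. Qed.

Definition const_endo (p : E) (u : TM) : TM := fun _ => u tt *m J_mx.

Local Notation g := (matrix_metric realizing_mx).

Lemma const_endo_endomorphism : endomorphism_field const_endo.
Proof.
split.
- by move=> p u _; exact: tangent_euclidean.
- move=> p a u v _ _; apply: TM_eq.
  have -> : (a *: const_endo p u + const_endo p v) tt =
    a *: (u tt *m J_mx) + v tt *m J_mx by [].
  by rewrite scalemxAl -mulmxDl.
- move=> U X oU /vector_field_euclidean cX; apply/vector_field_euclidean => k.
  by apply: class_C_mulmx => //; exact: class_C_cst.
Qed.

(** J is constant, so it commutes with derivatives of fields. *)
Lemma const_endo_integrable : integrable_structure const_endo.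
Proof.
move=> U X Y oU hX hY p Up; apply: TM_eq.
have dX := field_diff hX Up; have dY := field_diff hY Up.
pose JX := fun q => const_endo q (X q); pose JY := fun q => const_endo q (Y q).
have -> : nijenhuis const_endo X Y p tt =
  lie_bracket X Y p tt - lie_bracket JX Y p tt *m J_mx
  - lie_bracket X JY p tt *m J_mx + lie_bracket JX JY p tt by [].
rewrite !lie_bracket_euclidean.
have eX u : 'D_u (fun q => JX q tt) p = 'D_u (fun q => X q tt) p *m J_mx.
  exact: derive_mulmx_cst dX.
have eY u : 'D_u (fun q => JY q tt) p = 'D_u (fun q => Y q tt) p *m J_mx.
  exact: derive_mulmx_cst dY.
rewrite !eX !eY.
gen_derive; rewrite !mulmxBl !J_mxK.
exact: nijenhuis_terms_cancel.
Qed.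

Lemma const_endo_para_hermitian : para_hermitian g const_endo.
Proof.
split; last exact: const_endo_integrable.
split.
- exact: matrix_metric_pseudo_riemannian
    realizing_mx_smooth realizing_mx_sym realizing_mx_unit.
- exact: const_endo_endomorphism.
- by move=> p u _; apply: TM_eq; exact: J_mxK.
- move=> p u v _ _.
  have -> : g p (const_endo p u) (const_endo p v) =
    bilin (realizing_mx p) (u tt *m J_mx) (v tt *m J_mx) by [].
  rewrite /matrix_metric !bilin_realizing_mx !lincomb_J_mx (phs_skew hP).
  rewrite hessJ//.
  by rewrite mulrN -opprD.
Qed.

Lemma hess00 x y : hess 0 0 x y = 0.
Proof.
have := hess_scalar1 hA Jlin 0 x y 1 0 0; rewrite scale1r addr0 mul1r.
by rewrite -{1}[hess 0 0 x y]addr0 => /addrI <-.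
Qed.

Lemma bilin_realizing_mx0 x y :
  bilin (realizing_mx 0) (coords x) (coords y) = b x y.
Proof.
rewrite bilin_realizing_mx sqnorm0 !mulr0 addr0 mul1r !coordsK lincomb0.
by rewrite hess00 addr0.
Qed.

Lemma model_realized : geometrically_realized b J A g const_endo.
Proof.
exists (christoffel_conn realizing_mx); split.
  exact: christoffel_conn_levi_civita
    realizing_mx_smooth realizing_mx_sym realizing_mx_unit.
exists (0 : 'rV[R]_m), (fun x _ => coords x); split.
- by move=> a x y; apply: TM_eq; exact: coordsP.
- move=> x y /(congr1 (fun f : TM => lincomb (f tt))) /=.
  by rewrite !coordsK.
- apply/seteqP; split=> [u _|u _]; first exact: tangent_euclidean.
  by exists (lincomb (u tt)) => //; apply: TM_eq; exact: lincombK.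
- by move=> x y; exact: bilin_realizing_mx0.
- by move=> x; apply: TM_eq; rewrite /const_endo mul_J_mx coordsK.
- move=> x y z w U X Y Z oU UP hX hY hZ eX eY eZ.
  have crit := curvature_at_critical_point realizing_mx_smooth realizing_mx_unit
    Drealizing_mx_origin oU UP (fun=> coords w) hX hY hZ.
  rewrite eX eY eZ in crit; apply: etrans crit _.
  transitivity (2^-1 * (2 * hess x z y w + 2 * hess y w x z
                        - 2 * hess x w y z - 2 * hess y z x w)).
    by congr (_ * (_ + _ - _ - _)); exact: bilin_D2realizing_mx.
  rewrite -(hess_curvE hA Jlin JJ hG) /hess_curv.
  by field.
Qed.

End Realize.

(** * The equivalence *)
Theorem theorem1p2 (R : realType) (n : nat) (V : vectType R)
    (b : V -> V -> R) (J : V -> V) (A : V -> V -> V -> V -> R)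
    (hC : para_hermitian_curvature_model n b J A) :
  (exists (M : manifold R n.*2)
      (g : M -> (chart M -> 'rV[R]_(n.*2)) -> (chart M -> 'rV[R]_(n.*2)) -> R)
      (JM : M -> (chart M -> 'rV[R]_(n.*2)) -> (chart M -> 'rV[R]_(n.*2))),
    para_hermitian g JM /\ geometrically_realized b J A g JM)
  <-> para_gray_identity J A.
Proof.
case: hC => hP hA; have Jlin := phs_linear hP; have JJ := phs_involutive hP.
split=> [[M [g [JM [hPH hR]]]]|hG].
  exact: (realized_para_gray hA Jlin JJ hPH hR).
have hG' := (para_grayP hA Jlin JJ).1 hG.
have [e [s [be s2 he]]] := signature_basis (phs_signature hP).
exists (euclidean n.*2), (matrix_metric (realizing_mx b J A e)).
exists (const_endo J e).
split.
  exact: (const_endo_para_hermitian hP hA be s2 he).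
exact: (model_realized hP hA hG' be s2 he).
Qed.
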